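(* Let $L=P(\partial/\partial x_1,\dots,\partial/\partial x_n)$ be a weakly hypoelliptic differential operator on $\mathbb{R}^n$ with constant coefficients in $N'\times N$-matrices (acting on functions $\mathbb{R}^n\to\mathbb{R}^N$), and suppose $L$ is weighted homogeneous. Then every bounded $u\in\mathcal{H}(\mathbb{R}^n,L)$ is constant.
   Context: A polynomial $P$ in $n$ real variables with matrix coefficients is weighted homogeneous with weight $w=(w_1,\dots,w_n)$, $w_j>0$, if there is $k$ such that $P(t^{w_1}x_1,\dots,t^{w_n}x_n)=t^kP(x_1,\dots,x_n)$ for all $t>0$ and $x\in\mathbb{R}^n$; the operator $P(\partial/\partial x)$ is then called weighted homogeneous. $L$ is weakly hypoelliptic if for every open $\Omega\subset\mathbb{R}^n$, every distributional solution $u\in\mathcal{D}'(\Omega,\mathbb{R}^N)$ of $Lu=0$ is smooth. $\mathcal{H}(\mathbb{R}^n,L)\subset C^\infty(\mathbb{R}^n,\mathbb{R}^N)$ denotes the space of distributional solutions of $Lu=0$ on $\mathbb{R}^n$. *)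

(* Defs.v *)
From HB Require Import structures.
From mathcomp Require Import all_boot all_order all_algebra.
From mathcomp Require Import all_classical all_reals all_analysis.
Set Implicit Arguments. Unset Strict Implicit. Unset Printing Implicit Defensive.
Import Order.TTheory GRing.Theory Num.Theory.
Import numFieldNormedType.Exports.
Local Open Scope classical_set_scope.
Local Open Scope ring_scope.

Section Defs.
Variable R : realType.

Definition ebasis (n : nat) (i : 'I_n) : 'rV[R]_n := delta_mx 0 i.

Definition pderiv (n : nat) (V : normedModType R) (w : seq 'I_n)
    (f : 'rV[R]_n -> V) : 'rV[R]_n -> V :=
  foldr (fun i g => 'D_(ebasis i) g) f w.

Definition smooth_on (n : nat) (V : normedModType R) (O : set 'rV[R]_n)
    (f : 'rV[R]_n -> V) : Prop :=
  forall (vs : seq 'rV[R]_n) (x : 'rV[R]_n), O x ->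
    differentiable (foldr (fun v g => 'D_v g) f vs) x.

Definition supported_in (n : nat) (K : set 'rV[R]_n) (phi : 'rV[R]_n -> R) :=
  forall x, ~ K x -> phi x = 0.

Definition test_fun (n : nat) (O : set 'rV[R]_n) (phi : 'rV[R]_n -> R) : Prop :=
  smooth_on setT phi /\
  exists K : set 'rV[R]_n, [/\ compact K, K `<=` O & supported_in K phi].

(* Scalar distribution on O: a linear functional on test functions, continuous
   in the usual seminorm sense: for every compact K inside O there are C and k
   with |T phi| <= C * max_{|alpha| <= k} sup |d^alpha phi| for phi supported in K. *)
Definition distribution (n : nat) (O : set 'rV[R]_n)
    (T : ('rV[R]_n -> R) -> R) : Prop :=
  (forall (a : R) phi psi, test_fun O phi -> test_fun O psi ->
     T (fun x => a * phi x + psi x) = a * T phi + T psi) /\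
  (forall K : set 'rV[R]_n, compact K -> K `<=` O ->
     exists (C : R) (k : nat), forall phi (M : R),
       test_fun O phi -> supported_in K phi ->
       (forall (w : seq 'I_n) x, (size w <= k)%N -> `|pderiv w phi x| <= M) ->
       `|T phi| <= C * M).

Definition vdistribution (n N : nat) (O : set 'rV[R]_n)
    (T : 'I_N -> ('rV[R]_n -> R) -> R) : Prop :=
  forall j, distribution O (T j).

(* A polynomial P in n variables with N' x N matrix coefficients, given as a
   finite list of monomials: (word of variable indices, coefficient matrix).
   The monomial (w, A) is A * x_{w_1} * ... * x_{w_k}; the associated
   operator term is A * d/dx_{w_1} ... d/dx_{w_k}. *)
Definition mxpoly (n N' N : nat) := seq (seq 'I_n * 'M[R]_(N', N)).

Definition mxpoly_eval (n N' N : nat) (P : mxpoly n N' N) (x : 'rV[R]_n)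
    : 'M[R]_(N', N) :=
  \sum_(m <- P) (\prod_(i <- m.1) x 0 i) *: m.2.

Definition weighted_homogeneous (n N' N : nat) (P : mxpoly n N' N) : Prop :=
  exists w : 'I_n -> R, (forall j, 0 < w j) /\
  exists k : R, forall (t : R) (x : 'rV[R]_n), 0 < t ->
    mxpoly_eval P (\row_j (t `^ w j * x 0 j)) = t `^ k *: mxpoly_eval P x.

(* L T = 0 in the sense of distributions on O, where T = (T_1, ..., T_N):
   for each row i, sum_j sum_{(w,A) in P} A_ij (d^w T_j) = 0, with
   (d^w T_j)(phi) = (-1)^|w| T_j(d^w phi). *)
Definition dist_solution (n N' N : nat) (P : mxpoly n N' N) (O : set 'rV[R]_n)
    (T : 'I_N -> ('rV[R]_n -> R) -> R) : Prop :=
  forall (i : 'I_N') phi, test_fun O phi ->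
    \sum_(m <- P) \sum_(j < N)
       m.2 i j * ((-1) ^+ size m.1 * T j (pderiv m.1 phi)) = 0.

(* Integral over R^n of a (continuous, compactly supported) function,
   as an iterated Lebesgue integral (equal to the n-dimensional Lebesgue
   integral by Fubini for such integrands). *)
Fixpoint iint (n : nat) : ('rV[R]_n -> R) -> R :=
  match n with
  | 0 => fun f => f 0
  | n'.+1 => fun f =>
      Rintegral (@lebesgue_measure R) setT
        (fun t : R => iint (fun y : 'rV[R]_n' =>
                              f (row_mx (const_mx t : 'rV[R]_1) y)))
  end.

Definition smooth_dist (n N : nat) (O : set 'rV[R]_n)
    (T : 'I_N -> ('rV[R]_n -> R) -> R) : Prop :=
  exists f : 'rV[R]_n -> 'cV[R]_N, smooth_on O f /\
    forall j phi, test_fun O phi -> T j phi = iint (fun x => f x j 0 * phi x).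

Definition weakly_hypoelliptic (n N' N : nat) (P : mxpoly n N' N) : Prop :=
  forall O : set 'rV[R]_n, open O ->
    forall T, vdistribution O T -> dist_solution P O T -> smooth_dist O T.

Definition in_H (n N' N : nat) (P : mxpoly n N' N) (u : 'rV[R]_n -> 'cV[R]_N)
    : Prop :=
  smooth_on setT u /\
  exists T, [/\ vdistribution setT T, dist_solution P setT T &
    forall j phi, test_fun setT phi -> T j phi = iint (fun x => u x j 0 * phi x)].

End Defs.

(* Main.v *)
Require Import Defs.
From HB Require Import structures.
From mathcomp Require Import all_boot all_order all_algebra.
From mathcomp Require Import all_classical all_reals all_analysis.
From mathcomp Require Import ring lra.
Import Order.TTheory GRing.Theory Num.Theory.
Import numFieldNormedType.Exports.
Local Open Scope classical_set_scope.
Local Open Scope ring_scope.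
Set Implicit Arguments.
Unset Strict Implicit.
Unset Printing Implicit Defensive.

(** Suppose that a bounded solution u takes different values at x0 and at
    x0 + d e_l. By weighted homogeneity every
    x |-> u (x0 + (t^(w_1) x_1, ..., t^(w_n) x_n)) is again a solution with the
    same bound. With t_k := b^(k / w_l), the lacunary series
    v x := sum_k q^k u (x0 + t_k^w x) converges uniformly, so that v is a bounded
    continuous distributional solution; weak hypoellipticity makes it smooth.
    Along e_l, however, v is a Weierstrass function, and for q small and q b large
    it is not differentiable at 0. This replaces the closed graph theorem and the
    resulting derivative estimates by one explicit solution. *)

(** * Integrals of compactly supported continuous functions on the line *)

(** Each coordinate is dilated by its own power of t, so a sequence of dilations can be tuned to a
    single coordinate: with [t_k^(w_l) = b^k] the terms scale by exact powers of [b] along [e_l].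
    Hence constancy is proved one axis at a time. Two translations shape the rest. Homogeneity
    speaks about values of a polynomial, while the operator is a list of words whose letters are
    ordered; independence of monomials and symmetry of mixed derivatives bridge the two. And
    hypoellipticity yields a smooth density for the distribution attached to [v], not smoothness of
    [v] itself; testing against bump functions identifies the two at every point, both being
    continuous. Integrals are iterated one-dimensional ones, so linearity, bounds, positivity and
    diagonal substitution are obtained by induction on the dimension, for continuous functions
    supported in a box. *)

Section RealIntegral.
Variable R : realType.
Implicit Types (f g : R -> R) (r M : R).
Local Notation mu := (@lebesgue_measure R).

Definition supp_seg r f := forall t, r < `|t| -> f t = 0.

Lemma supp_seg_le r r' f : r <= r' -> supp_seg r f -> supp_seg r' f.
Proof. by move=> rr' fr t /(le_lt_trans rr'); exact: fr. Qed.

Lemma supp_segE r f : supp_seg r f -> f \_ `[- r, r] = f.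
Proof.
move=> fr; apply/funext => t; rewrite patchE; case: ifPn => // tr.
rewrite fr// ltNge; apply: contra tr => tr.
by rewrite inE/= in_itv/= -ler_norml.
Qed.

Lemma supp_seg_integrable r f : continuous f -> supp_seg r f ->
  mu.-integrable setT (EFin \o f).
Proof.
move=> cf fr.
have : mu.-integrable `[- r, r] (EFin \o f).
  apply: continuous_compact_integrable; first exact: segment_compact.
  exact: continuous_subspaceT.
by rewrite integrable_mkcond// restrict_EFin supp_segE.
Qed.

Lemma Rintegral_supp_seg r f : supp_seg r f ->
  Rintegral mu setT f = Rintegral mu `[- r, r] f.
Proof. by move=> fr; rewrite [RHS]Rintegral_mkcond supp_segE. Qed.

Lemma Rintegral_itv_cst (a b M : R) : a <= b ->
  Rintegral mu `[a, b] (cst M) = M * (b - a).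
Proof.
move=> ab; rewrite Rintegral_cst//=; congr (_ * _).
rewrite lebesgue_measure_itv/= lte_fin.
by case: ltgtP ab => //= -> _; rewrite subrr.
Qed.

Lemma le_Rintegral_supp_seg r f M : 0 <= r -> continuous f -> supp_seg r f ->
  (forall t, `|f t| <= M) -> `|Rintegral mu setT f| <= r *+ 2 * M.
Proof.
move=> r0 cf fr fM; rewrite (Rintegral_supp_seg fr).
have fi : mu.-integrable `[- r, r] (EFin \o f).
  by apply: integrableS (supp_seg_integrable cf fr).
apply: (le_trans (le_normr_Rintegral _ fi)) => //.
have -> : r *+ 2 * M = Rintegral mu `[- r, r] (cst M).
  by rewrite Rintegral_itv_cst; [ring|lra].
apply: le_Rintegral => //; first exact: integrable_norm fi.
apply: continuous_compact_integrable; first exact: segment_compact.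
by apply: continuous_subspaceT => x; exact: cst_continuous.
Qed.

Lemma Rintegral_gt0 r f t0 : continuous f -> supp_seg r f ->
  (forall t, 0 <= f t) -> 0 < f t0 -> 0 < Rintegral mu setT f.
Proof.
move=> cf fr f0 ft0.
have : \forall t \near t0, f t0 / 2 < f t.
  by have /cvgr_gt := cf t0; apply; lra.
case/nbhs_ballP => e /= e0 he.
have fi := supp_seg_integrable cf fr.
pose d := e / 2; have d0 : 0 < d by rewrite /d; lra.
apply: (@lt_le_trans _ _ (Rintegral mu `[t0 - d, t0 + d] (cst (f t0 / 2)))).
  rewrite Rintegral_itv_cst; last lra.
  by apply: mulr_gt0; lra.
rewrite Rintegral_mkcond; apply: le_Rintegral => //.
  have : mu.-integrable `[t0 - d, t0 + d] (EFin \o cst (f t0 / 2)).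
    apply: continuous_compact_integrable; first exact: segment_compact.
    by apply: continuous_subspaceT => x; exact: cst_continuous.
  by move/integrable_mkcond; rewrite restrict_EFin; apply.
move=> t _; rewrite patchE; case: ifPn => // /[!inE]/=; rewrite in_itv/= => td.
apply/ltW/he; rewrite /ball/= ltr_norml.
by move: td; rewrite /d => /andP[]; lra.
Qed.

Lemma RintegralT_lin r (a : R) f g :
  continuous f -> continuous g -> supp_seg r f -> supp_seg r g ->
  Rintegral mu setT (fun t => a * f t + g t) =
  a * Rintegral mu setT f + Rintegral mu setT g.
Proof.
move=> cf cg fr gr; have fi := supp_seg_integrable cf fr.
rewrite RintegralD//; [rewrite RintegralZl//| |exact: supp_seg_integrable gr].
apply: (@supp_seg_integrable r).
  by move=> t; apply: cvgM; [exact: cvg_cst|exact: cf].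
by move=> t tr; rewrite fr// mulr0.
Qed.

Lemma Rintegral_affine r (a b : R) f : 0 < b -> continuous f -> supp_seg r f ->
  Rintegral mu setT (fun t => f (a + b * t)) = b^-1 * Rintegral mu setT f.
Proof.
move=> b0 cf fr.
(* Chosen with [b * s = |r| + |a|], so that [[- s, s]] contains the support of [f \o F] and its
   image under [F] contains that of [f]; [r] may be negative, hence the absolute value. *)
pose s := b^-1 * (`|r| + `|a|).
have bs : b * s = `|r| + `|a| by rewrite /s mulrA divff ?mul1r// gt_eqF.
have s0 : 0 <= s by rewrite mulr_ge0// ?invr_ge0 ?ltW// addr_ge0.
pose F t := a + b * t.
have dF (t : R) : is_derive t (1 : R) F b.
  have -> : F = cst a + b *: (@id R) by apply/funext.
  have := is_deriveD (is_derive_cst a t (1 : R)) (is_deriveZ b (is_derive_id t (1 : R))).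
  by rewrite add0r /GRing.scale/= mulr1.
have F'E : derive1 F = cst b.
  by apply/funext => t; rewrite derive1E; exact: (@derive_val _ _ _ _ _ _ _ (dF t)).
have cF : continuous F.
  by move=> t; apply/differentiable_continuous/derivable1_diffP; case: (dF t).
have fFs : supp_seg s (f \o F).
  move=> t ts; apply: fr; rewrite /F.
  have : `|b * t| <= `|a + b * t| + `|a|.
    by rewrite -{1}(addrK a (b * t)) (addrC _ a) ler_normB.
  rewrite normrM (gtr0_norm b0) => h.
  have : b * s < b * `|t| by rewrite ltr_pM2l.
  by rewrite bs; have := ler_norm r; lra.
have fT : supp_seg (`|F (- s)| + `|F s| + `|r|) f.
  by apply: supp_seg_le fr; have := ler_norm r;
     have := normr_ge0 (F s); have := normr_ge0 (F (-s)); lra.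
rewrite (Rintegral_supp_seg fFs).
have fFi : f \_ `[F (- s), F s] = f.
  apply/funext => t; rewrite patchE; case: ifPn => // tr.
  rewrite fr// ltNge; apply: contra tr => tr.
  rewrite inE/= in_itv/= /F mulrN bs; move: tr; rewrite ler_norml => /andP[].
  have := ler_norm r; have := ler_norm a; have := ler_norm (- a); rewrite normrN.
  by move=> *; apply/andP; split; lra.
have -> : Rintegral mu setT f = Rintegral mu `[F (- s), F s] f.
  by rewrite [RHS]Rintegral_mkcond fFi.
have := @integration_by_substitution_increasing R F f (- s) s.
rewrite F'E; move=> H.
have -> : Rintegral mu `[F (- s), F s] f =
    Rintegral mu `[- s, s] (fun t => b * (f \o F) t).
  rewrite /Rintegral H.
  - by congr fine; apply: eq_integral => x _; rewrite mulrC.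
  - lra.
  - by move=> x y _ _ xy; rewrite /F ltrD2l ltr_pM2l.
  - by move=> x _; exact: cst_continuous.
  - exact: is_cvg_cst.
  - exact: is_cvg_cst.
  - by split; [move=> x _; case: (dF x)|apply: cvg_at_right_filter; exact: cF|
      apply: cvg_at_left_filter; exact: cF].
  - exact: continuous_subspaceT.
rewrite RintegralZl//; first by rewrite mulrA mulVf ?mul1r ?gt_eqF.
apply: continuous_compact_integrable; first exact: segment_compact.
apply: continuous_subspaceT => x; apply: continuous_comp; [exact: cF|exact: cf].
Qed.

End RealIntegral.

(** * The iterated integral *)

Section IteratedIntegral.
Variable R : realType.
Local Notation mu := (@lebesgue_measure R).

Lemma mx_norm_le m n (A : 'M[R]_(m, n)) (e : R) :
  0 <= e -> (forall i j, `|A i j| <= e) -> `|A| <= e.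
Proof.
move=> e0 Ae; rewrite /Num.norm/= mx_normrE.
by apply: bigmax_le => // -[i j] _; exact: Ae.
Qed.

Lemma mx_norm_ge m n (A : 'M[R]_(m, n)) i j : `|A i j| <= `|A|.
Proof.
by rewrite [leRHS]/Num.norm/= mx_normrE; exact: (le_bigmax _ _ (i, j)).
Qed.

Definition vcons n (t : R) (y : 'rV[R]_n) : 'rV[R]_n.+1 :=
  row_mx (const_mx t : 'rV_1) y.

Lemma vcons_ord0 n t (y : 'rV[R]_n) : vcons t y 0 ord0 = t.
Proof.
by rewrite mxE; case: splitP => [k _|k]; rewrite ?mxE.
Qed.

Lemma vcons_lift n t (y : 'rV[R]_n) i : vcons t y 0 (lift ord0 i) = y 0 i.
Proof.
rewrite mxE; case: splitP => [[k k1]/= h|k]; first by exfalso; move: k1; rewrite -h.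
by rewrite /= /bump add1n add1n => -[/val_inj ->].
Qed.

Lemma vconsK n (x : 'rV[R]_n.+1) :
  x = vcons (x 0 ord0) (\row_i x 0 (lift ord0 i)).
Proof.
apply/rowP => i; case: (unliftP ord0 i) => [j|] ->.
  by rewrite vcons_lift mxE.
by rewrite vcons_ord0.
Qed.

Lemma vcons_continuous n :
  continuous (fun p : R * 'rV[R]_n => vcons p.1 p.2).
Proof.
move=> [t0 y0]; apply/cvgrPdist_le => e e0.
have h1 : \forall p \near (t0, y0), `|t0 - p.1| <= e.
  have /cvgrPdist_le : p.1 @[p --> (t0, y0)] --> t0 by exact: cvg_fst.
  exact.
have h2 : \forall p \near (t0, y0), `|y0 - p.2| <= e.
  have /cvgrPdist_le : p.2 @[p --> (t0, y0)] --> y0 by exact: cvg_snd.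
  exact.
near=> p; apply: mx_norm_le; first exact: ltW.
move=> i j; rewrite !ord1.
have -> : (vcons t0 y0 - vcons p.1 p.2) 0 j =
  vcons t0 y0 0 j - vcons p.1 p.2 0 j by rewrite !mxE.
case: (unliftP ord0 j) => [k|] ->.
  rewrite !vcons_lift; have := mx_norm_ge (y0 - p.2) 0 k; rewrite !mxE.
  by move=> /le_trans; apply; near: p.
by rewrite !vcons_ord0; near: p.
Unshelve. all: by end_near. Qed.

Lemma vcons_cvg n (T : Type) (F : set_system T) (FF : Filter F) (s : T -> R)
    (p : T -> 'rV[R]_n) a b :
  s x @[x --> F] --> a -> p x @[x --> F] --> b ->
  vcons (s x) (p x) @[x --> F] --> vcons a b.
Proof.
move=> sa pb.
exact: (cvg_comp _ (fun q : R * 'rV[R]_n => vcons q.1 q.2) (cvg_pair sa pb)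
  (@vcons_continuous n (a, b))).
Qed.

Definition box n (r : R) : set 'rV[R]_n := [set x | forall i, `|x 0 i| <= r].

Lemma box_compact n r : compact (@box n r).
Proof.
have -> : @box n r = [set x : 'rV[R]_n | forall i, `[- r, r]%classic (x 0 i)].
  by apply/seteqP; split => x /= h i; move: (h i); rewrite in_itv/= ler_norml.
apply: (@rV_compact _ _ (fun=> `[- r, r]%classic)) => i.
exact: segment_compact.
Qed.

Lemma compact_box n (K : set 'rV[R]_n) : compact K ->
  exists2 r : R, 0 <= r & K `<=` @box n r.
Proof.
move=> /compact_bounded [M [_ hM]]; exists (`|M| + 1).
  by rewrite addr_ge0.
move=> x Kx i; apply: le_trans (mx_norm_ge x 0 i) _.
by apply: hM => //; have := ler_norm M; lra.
Qed.

(** Fixing the first coordinate preserves this class with the same [r], which is what inductions on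
    the dimension require; a Euclidean ball would not slice so evenly. *)
Definition ccs n (r : R) (f : 'rV[R]_n -> R) :=
  continuous f /\ supported_in (@box n r) f.

Lemma ccs_le n r r' (f : 'rV[R]_n -> R) : r <= r' -> ccs r f -> ccs r' f.
Proof.
move=> rr' [cf f0]; split => // x xr'; apply: f0 => xr; apply: xr' => i.
exact: le_trans (xr i) rr'.
Qed.

Lemma ccs_slice n r (f : 'rV[R]_n.+1 -> R) t : ccs r f ->
  ccs r (fun y => f (vcons t y)).
Proof.
move=> [cf f0]; split.
  move=> y; apply: (@continuous_comp _ _ _ (vcons t) f); last exact: cf.
  apply: (@vcons_cvg _ _ (nbhs y) _ (fun=> t) id); first exact: cvg_cst.
  exact: cvg_id.
move=> y yr; apply: f0 => h; apply: yr => i.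
by have := h (lift ord0 i); rewrite vcons_lift.
Qed.

Lemma ccs_slice0 n r (f : 'rV[R]_n.+1 -> R) t : ccs r f -> r < `|t| ->
  forall y, f (vcons t y) = 0.
Proof.
move=> [_ f0] tr y; apply: f0 => /(_ ord0); rewrite vcons_ord0.
by rewrite leNgt tr.
Qed.

Lemma ccs_lin n r a (f g : 'rV[R]_n -> R) : ccs r f -> ccs r g ->
  ccs r (fun x => a * f x + g x).
Proof.
move=> [cf f0] [cg g0]; split.
  move=> x; apply: (@cvgD _ _ _ (nbhs x)); last exact: cg.
  by apply: (@cvgM _ _ (nbhs x)); [exact: cvg_cst|exact: cf].
by move=> x xr; rewrite f0// g0// mulr0 addr0.
Qed.

Lemma iintS n (f : 'rV[R]_n.+1 -> R) :
  iint f = Rintegral mu setT (fun t => iint (fun y => f (vcons t y))).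
Proof. by []. Qed.

(** Linearity and the bound go through the induction together: in dimension [n] both are needed to
    show that slice integrals depend continuously on the first coordinate, and this continuity makes
    the outer integral in dimension [n.+1] manageable. *)
Definition iint_linear_bounded n := forall r : R, 0 <= r ->
  (forall a (f g : 'rV[R]_n -> R), ccs r f -> ccs r g ->
    iint (fun x => a * f x + g x) = a * iint f + iint g) /\
  (forall (f : 'rV[R]_n -> R) M, ccs r f -> (forall x, `|f x| <= M) ->
    `|iint f| <= (r *+ 2) ^+ n * M).

Lemma iint_slice_supp n r (f : 'rV[R]_n.+1 -> R) : iint_linear_bounded n ->
  0 <= r -> ccs r f -> supp_seg r (fun t => iint (fun y => f (vcons t y))).
Proof.
move=> lb r0 fr t tr; have [_ bnd] := lb r r0.
have := bnd (fun y => f (vcons t y)) 0 (ccs_slice t fr).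
rewrite mulr0 normr_le0 => /(_ _)/eqP; apply=> y.
by rewrite (ccs_slice0 fr tr) normr0.
Qed.

Lemma iint_slice_continuous n r (f : 'rV[R]_n.+1 -> R) :
  iint_linear_bounded n -> 0 <= r -> ccs r f ->
  continuous (fun t : R => iint (fun y => f (vcons t y))).
Proof.
move=> lb r0 fr t0; have [lin bnd] := lb r r0.
apply/cvgrPdist_le => e e0.
pose c := (r *+ 2) ^+ n; have c0 : 0 <= c by rewrite exprn_ge0// mulrn_wge0.
pose d := e / (c + 1); have d0 : 0 < d by rewrite divr_gt0//; lra.
(* compactness of the box makes the convergence of the slices uniform *)
have ncov := (compact_near_coveringP _).1 (@box_compact n r).
have [cf f0] := fr.
have : \forall t \near t0, @box n r `<=`
    (fun y => `|f (vcons t0 y) - f (vcons t y)| <= d).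
  apply: (ncov R (nbhs t0)
    (fun t y => `|f (vcons t0 y) - f (vcons t y)| <= d)) => y0 _.
  pose g (p : 'rV[R]_n * R) := f (vcons t0 p.1) - f (vcons p.2 p.1).
  have cp (s : 'rV[R]_n * R -> R) : continuous s ->
      continuous (fun p => f (vcons (s p) p.1)).
    move=> cs p; apply: (@continuous_comp _ _ _ (fun p => vcons (s p) p.1) f).
      apply: (@vcons_cvg _ _ (nbhs p) _ s fst); first exact: cs.
      by case: p => ? ?; exact: cvg_fst.
    exact: cf.
  have cg : continuous g.
    move=> p; apply: (@cvgB _ _ _ (nbhs p)).
      by apply: (cp (fun=> t0)) => q; exact: cvg_cst.
    by apply: (cp snd) => -[? ?]; exact: cvg_snd.
  have /cvgrPdist_le/(_ d d0) := cg (y0, t0).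
  by apply: filterS => q; rewrite {1}/g/= subrr sub0r normrN.
apply: filterS => t ht.
have -> : iint (fun y => f (vcons t0 y)) - iint (fun y => f (vcons t y)) =
    iint (fun y => -1 * f (vcons t y) + f (vcons t0 y)).
  by rewrite lin; [lra|exact: ccs_slice|exact: ccs_slice].
apply: (@le_trans _ _ (c * d)).
  apply: bnd; first by apply: ccs_lin; exact: ccs_slice.
  move=> y; rewrite mulN1r addrC.
  have [yr|yr] := pselect (box r y); first exact: ht.
  by have [_ h] := ccs_slice t fr; have [_ h0] := ccs_slice t0 fr;
     rewrite h// h0// subrr normr0 ltW.
rewrite /d mulrCA ler_piMr//; first exact: ltW.
by rewrite ler_pdivrMr; lra.
Qed.

Lemma iint_lin_bnd n : iint_linear_bounded n.
Proof.
elim: n => [|n lb] r r0.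
  by split => [//|f M _ fM]; rewrite expr0 mul1r; exact: fM.
have [lin bnd] := lb r r0; split.
- move=> a f g fr gr; rewrite !iintS.
  rewrite -(@RintegralT_lin _ r).
  + congr (Rintegral _ _ _); apply/funext => t; apply: lin; exact: ccs_slice.
  + exact: iint_slice_continuous fr.
  + exact: iint_slice_continuous gr.
  + exact: iint_slice_supp fr.
  + exact: iint_slice_supp gr.
- move=> f M fr fM; rewrite iintS exprS -mulrA.
  apply: le_Rintegral_supp_seg => //.
  + exact: iint_slice_continuous fr.
  + exact: iint_slice_supp fr.
  + by move=> t; apply: bnd => //; exact: ccs_slice.
Qed.

Lemma iint_lin n r a (f g : 'rV[R]_n -> R) : 0 <= r -> ccs r f -> ccs r g ->
  iint (fun x => a * f x + g x) = a * iint f + iint g.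
Proof. by move=> /(@iint_lin_bnd n)[+ _]; exact. Qed.

Lemma le_norm_iint n r (f : 'rV[R]_n -> R) M : 0 <= r -> ccs r f ->
  (forall x, `|f x| <= M) -> `|iint f| <= (r *+ 2) ^+ n * M.
Proof. by move=> /(@iint_lin_bnd n)[_]; exact. Qed.

Lemma ccs0 n r : @ccs n r (fun=> 0).
Proof. by split=> // x; exact: (@cvg_cst _ _ _ (nbhs x)). Qed.

Lemma iint0 n : iint (fun _ : 'rV[R]_n => 0 : R) = 0.
Proof.
apply/eqP; rewrite -normr_le0 -[leRHS](mulr0 ((0 *+ 2) ^+ n)).
by apply: le_norm_iint (ccs0 n 0) _ => // x; rewrite normr0.
Qed.

Lemma iintZ n r a (f : 'rV[R]_n -> R) : 0 <= r -> ccs r f ->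
  iint (fun x => a * f x) = a * iint f.
Proof.
move=> r0 cf; have := iint_lin a r0 cf (ccs0 n r); rewrite iint0 addr0 => <-.
by congr iint; apply/funext => x; rewrite addr0.
Qed.

Lemma iint_ge0 n (f : 'rV[R]_n -> R) : (forall x, 0 <= f x) -> 0 <= iint f.
Proof.
elim: n f => [f|n IH f] f0; first exact: f0.
by apply: Rintegral_ge0 => t _; exact: IH.
Qed.

Lemma iint_gt0 n r (f : 'rV[R]_n -> R) x0 : 0 <= r -> ccs r f ->
  (forall x, 0 <= f x) -> 0 < f x0 -> 0 < iint f.
Proof.
move=> r0; elim: n f x0 => [f x0 _ _|n IH f x0 fr f0 fx0].
  by rewrite (_ : x0 = 0)//; apply/rowP => -[].
rewrite iintS; apply: (@Rintegral_gt0 _ r _ (x0 0 ord0)).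
- exact: (iint_slice_continuous (@iint_lin_bnd n) r0 fr).
- exact: (iint_slice_supp (@iint_lin_bnd n) r0 fr).
- by move=> t; exact: iint_ge0.
- apply: (IH _ (\row_i x0 0 (lift ord0 i))).
  + exact: ccs_slice.
  + by [].
  + by rewrite -vconsK.
Qed.

Definition affine_diag n (a b : 'I_n -> R) (x : 'rV[R]_n) : 'rV[R]_n :=
  \row_i (a i + b i * x 0 i).

(** Since the map is diagonal, the one-dimensional substitution applies coordinate by coordinate.
    Such maps cover the weighted dilations about an arbitrary base point. *)
Lemma iint_affine n r (a b : 'I_n -> R) (f : 'rV[R]_n -> R) :
  0 <= r -> (forall i, 0 < b i) -> ccs r f ->
  iint (f \o affine_diag a b) = (\prod_i b i)^-1 * iint f.
Proof.
move=> r0; elim: n a b f => [a b f _ _|n IH a b f b0 fr].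
  rewrite big_ord0 invr1 mul1r/=; congr f; apply/rowP => -[]//.
pose a' i := a (lift ord0 i); pose b' i := b (lift ord0 i).
rewrite iintS big_ord_recl invfM -mulrA mulrCA.
have -> : (fun t => iint (fun y => (f \o affine_diag a b) (vcons t y))) =
    (fun t => (\prod_i b' i)^-1 *
       iint (fun y => f (vcons (a ord0 + b ord0 * t) y))).
  apply/funext => t; rewrite -(IH a' b').
  - congr iint; apply/funext => y /=; congr f; apply/rowP => i.
    case: (unliftP ord0 i) => [j|] ->.
      by rewrite vcons_lift [RHS]mxE mxE vcons_lift.
    by rewrite vcons_ord0 mxE vcons_ord0.
  - by move=> i; exact: b0.
  - exact: ccs_slice.
pose G t := iint (fun y => f (vcons t y)).
have cG : continuous G := iint_slice_continuous (@iint_lin_bnd n) r0 fr.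
have sG : supp_seg r G := iint_slice_supp (@iint_lin_bnd n) r0 fr.
have cH : continuous (fun t => G (a ord0 + b ord0 * t)).
  move=> t; apply: (@continuous_comp _ _ _ (fun t => a ord0 + b ord0 * t) G);
    last exact: cG.
  apply: cvgD; first exact: cvg_cst.
  by apply: cvgM; [exact: cvg_cst|exact: cvg_id].
have sH : supp_seg ((b ord0)^-1 * (r + `|a ord0|)) (fun t => G (a ord0 + b ord0 * t)).
  move=> t; rewrite -(ltr_pM2l (b0 ord0)) mulrA divff ?mul1r ?gt_eqF// => h.
  apply: sG; have := ler_normB (a ord0 + b ord0 * t) (a ord0).
  by rewrite addrC addKr normrM (gtr0_norm (b0 _)); lra.
rewrite RintegralZl//; last exact: supp_seg_integrable cH sH.
by rewrite (Rintegral_affine _ (b0 ord0) cG sG) mulrCA.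
Qed.

End IteratedIntegral.

(** * Linear independence of monomials *)

Lemma digits_inj (B n : nat) (f g : 'I_n -> nat) :
  (forall i, f i < B)%N -> (forall i, g i < B)%N ->
  (\sum_(i < n) f i * B ^ i = \sum_(i < n) g i * B ^ i)%N -> f =1 g.
Proof.
elim: n f g => [f g _ _ _ [//]|n IH f g fB gB].
have step (h : 'I_n.+1 -> nat) : (\sum_(i < n.+1) h i * B ^ i =
    h ord0 + (\sum_(i < n) h (lift ord0 i) * B ^ i) * B)%N.
  rewrite big_ord_recl expn0 muln1 big_distrl/=; congr addn.
  by apply: eq_bigr => i _; rewrite expnSr mulnA.
have B0 : (0 < B)%N by apply: leq_ltn_trans (fB ord0).
rewrite !step => E.
have E0 : f ord0 = g ord0.
  have := congr1 (modn^~ B) E; rewrite !(addnC _ (_ * B)%N) !modnMDl.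
  by rewrite !modn_small.
move: E; rewrite E0 => /addnI/eqP; rewrite eqn_pmul2r// => /eqP E.
move=> i; case: (unliftP ord0 i) => [j|] -> //.
by apply: (IH (fun i => f (lift ord0 i)) (fun i => g (lift ord0 i))).
Qed.

Section MonomialIndependence.
Variables (R : numDomainType) (n : nat).
Implicit Types (w : seq 'I_n) (Q : seq (seq 'I_n * R)).

Lemma poly_eval0 (p : {poly R}) : (forall x, p.[x] = 0) -> p = 0.
Proof.
move=> p0; apply/eqP; apply: contraT => pN0.
(* The naturals below [size p] are distinct in characteristic 0: one root too many. *)
pose rs : seq R := [seq i%:R | i <- iota 0 (size p)].
have : (size rs < size p)%N.
  apply: max_poly_roots => //.
    by apply/allP => x _; apply/rootP.
  rewrite map_inj_uniq ?iota_uniq// => i j /eqP.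
  by rewrite eqr_nat => /eqP.
by rewrite size_map size_iota ltnn.
Qed.

Definition kron (B : nat) w := (\sum_(i <- w) B ^ i)%N.

Lemma kronE B w : kron B w = (\sum_(i < n) count_mem i w * B ^ i)%N.
Proof.
rewrite /kron; elim: w => [|j w IH].
  by rewrite big_nil big1.
rewrite big_cons IH /= [RHS](eq_bigr (fun i : 'I_n =>
  (j == i) * B ^ i + count_mem i w * B ^ i)%N); last by move=> i _; rewrite mulnDl.
rewrite big_split/=; congr addn.
rewrite (bigD1 j)//= eqxx mul1n big1 ?addn0// => i.
by rewrite eq_sym => /negbTE ->.
Qed.

Lemma kron_perm B w1 w2 : (size w1 < B)%N -> (size w2 < B)%N ->
  kron B w1 = kron B w2 -> perm_eq w1 w2.
Proof.
move=> s1 s2; rewrite !kronE => /digits_inj E.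
apply/allP => i _ /=; apply/eqP; apply: E => j.
- exact: leq_ltn_trans (count_size _ _) s1.
- exact: leq_ltn_trans (count_size _ _) s2.
Qed.

(* Substituting s^(B^i) for the i-th variable (Kronecker) turns distinct
   monomials into distinct powers of s. *)
Lemma monomials_independent Q (g : seq 'I_n -> R) :
  (forall x : 'rV[R]_n, \sum_(m <- Q) m.2 * \prod_(i <- m.1) x 0 i = 0) ->
  (forall w1 w2, perm_eq w1 w2 -> g w1 = g w2) ->
  \sum_(m <- Q) m.2 * g m.1 = 0.
Proof.
move=> Q0 gP.
pose B := (\max_(m <- Q) size m.1).+1.
have szB m : m \in Q -> (size m.1 < B)%N.
  by move=> mQ; rewrite ltnS (big_rem m)//= leq_maxl.
pose e (m : seq 'I_n * R) := kron B m.1.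
pose p : {poly R} := \sum_(m <- Q) m.2 *: 'X^(e m).
have p0 : p = 0.
  apply: poly_eval0 => s; rewrite -[RHS](Q0 (\row_i s ^+ (B ^ i))).
  rewrite horner_sum; apply: eq_bigr => m _.
  rewrite hornerZ hornerXn; congr (_ * _); rewrite /e /kron expr_sum.
  by apply: eq_bigr => i _; rewrite mxE.
(* [G] reads [g] off the Kronecker exponent, at the first monomial of [Q] having it. Words sharing
   an exponent are permutations of each other, so the choice does not matter, and the claim becomes
   a pairing of the coefficients of [p = 0] with [G]. *)
pose G k := g (nth ([::], 0) Q (find (fun m => e m == k) Q)).1.
have GE m : m \in Q -> G (e m) = g m.1.
  move=> mQ; have hQ : has (fun m' => e m' == e m) Q.
    by apply/hasP; exists m => //=.
  apply: gP; apply: (@kron_perm B).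
  - by apply: szB; rewrite mem_nth// -has_find.
  - exact: szB.
  - by apply/eqP; exact: (nth_find _ hQ).
pose K := (\max_(m <- Q) e m).+1.
have eK m : m \in Q -> (e m < K)%N.
  by move=> mQ; rewrite ltnS (big_rem m)//= leq_maxl.
transitivity (\sum_(k < K) p`_k * G k); last first.
  by rewrite big1// => k _; rewrite p0 coef0 mul0r.
under [RHS]eq_bigr => k _ do rewrite coef_sum big_distrl/=.
rewrite exchange_big/= !big_seq; apply: eq_bigr => m mQ.
rewrite (bigD1 (Ordinal (eK m mQ)))//= coefZ coefXn eqxx mulr1 GE//.
rewrite big1 ?addr0// => k km; rewrite coefZ coefXn.
case: eqP => [E|_]; last by rewrite mulr0 mul0r.
by case/eqP: km; apply/val_inj.
Qed.

End MonomialIndependence.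

(** * Smooth functions and test functions *)

Lemma derive_line_ext (R : realType) (V W : normedModType R) (f : V -> R)
    (g : W -> R) x y v w :
  (forall h : R, f (h *: v + x) = g (h *: w + y)) -> 'D_v f x = 'D_w g y.
Proof.
move=> fg; have fg0 : f x = g y by have := fg 0; rewrite !scale0r !add0r.
have E : (fun h : R => h^-1 *: (f (h *: v + x) - f x)) =
    (fun h : R => h^-1 *: (g (h *: w + y) - g y)).
  by apply/funext => h; rewrite fg fg0.
by rewrite /derive/= E.
Qed.

Section Smooth.
Variables (R : realType) (n : nat).
Implicit Types (f g : 'rV[R]_n -> R) (v x y : 'rV[R]_n).

Local Notation smooth := (@smooth_on R n R setT).

Lemma smooth_differentiable f x : smooth f -> differentiable f x.
Proof. by move=> /(_ [::] x I). Qed.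

Lemma smooth_continuous f : smooth f -> continuous f.
Proof. by move=> sf x; exact/differentiable_continuous/smooth_differentiable. Qed.

Lemma smooth_derive f v : smooth f -> smooth ('D_v f).
Proof. by move=> sf vs x _; rewrite -foldr_rcons; exact: sf. Qed.

Lemma smooth_pderiv w f : smooth f -> smooth (pderiv w f).
Proof. by move=> sf; elim: w => [//|i w IH] /=; exact: smooth_derive. Qed.

Lemma is_derive_line f x v (s : R) : derivable f (x + s *: v) v ->
  is_derive s (1 : R) (fun s => f (x + s *: v)) ('D_v f (x + s *: v)).
Proof.
move=> df.
have E : (fun h : R => h^-1 *: (f (x + (h *: 1 + s) *: v) - f (x + s *: v))) =
    (fun h : R => h^-1 *: (f (h *: v + (x + s *: v)) - f (x + s *: v))).
  apply/funext => h; congr (_ *: (f _ - _)).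
  by rewrite scalerDl scaler1 addrCA.
by split; rewrite /derivable /derive/= E.
Qed.

Lemma line_continuous x v : continuous (fun s : R => x + s *: v).
Proof.
move=> s; apply: (@cvgD _ _ _ (nbhs s)); first exact: cvg_cst.
apply: (@cvgZ _ _ _ (nbhs s)); [exact: cvg_id|exact: cvg_cst].
Qed.

Lemma line_MVT f x v (h : R) : 0 <= h -> (forall y, differentiable f y) ->
  exists2 c : R, 0 <= c <= h & f (x + h *: v) - f x = 'D_v f (x + c *: v) * h.
Proof.
move=> h0 df.
have [||c ch E] := @MVT_segment R (fun s => f (x + s *: v))
    (fun s => 'D_v f (x + s *: v)) 0 h h0.
- by move=> s _; apply: is_derive_line; exact: diff_derivable.
- apply: continuous_subspaceT => s.
  apply: (@continuous_comp _ _ _ (fun s : R => x + s *: v) f).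
    exact: line_continuous.
  exact/differentiable_continuous/df.
- by exists c => //; rewrite in_itv/= in ch; rewrite scale0r addr0 subr0 in E.
Qed.

(** The mean value theorem is applied along [v] to the difference in direction [w], then along [w]
    to ['D_v f]. The left side is symmetric in [v] and [w], the right side is not: this is the
    source of the symmetry of mixed derivatives. *)
Lemma second_difference f x v w (h : R) : 0 <= h -> smooth f ->
  exists2 y, `|y - x| <= h * (`|v| + `|w|) &
    f (x + h *: v + h *: w) - f (x + h *: v) - (f (x + h *: w) - f x) =
    'D_w ('D_v f) y * h * h.
Proof.
move=> h0 sf.
pose g y := f (y + h *: w) - f y.
have dfw y : differentiable (fun y => f (y + h *: w)) y.
  apply: (@differentiable_comp _ _ _ _ (fun y => y + h *: w) f).
    by apply: differentiableD.
  exact: (smooth_differentiable _ sf).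
have dg y : differentiable g y.
  by apply: differentiableB => //; exact: (smooth_differentiable _ sf).
have gE y : 'D_v g y = 'D_v f (y + h *: w) - 'D_v f y.
  rewrite /g deriveB; [|exact: diff_derivable|
    by apply/diff_derivable; exact: (smooth_differentiable _ sf)].
  by congr (_ - _); apply: derive_line_ext => t; rewrite addrA.
have [c /andP[c0 ch] cE] := line_MVT x v h0 dg.
have [d /andP[d0 dh] dE] := line_MVT (x + c *: v) w h0
  (fun y => smooth_differentiable y (smooth_derive v sf)).
exists (x + c *: v + d *: w).
  rewrite -(addrA x) (addrC x) addrK.
  apply: (le_trans (ler_normD _ _)); rewrite !normrZ !ger0_norm// mulrDr.
  by apply: lerD; apply: ler_wpM2r.
rewrite -dE -gE -cE /g; lra.
Qed.

Lemma dist_le_half (p q s e : R) :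
  `|p - s| < e / 2 -> `|q - s| < e / 2 -> `|p - q| <= e.
Proof.
rewrite !ltr_norml => /andP[? ?] /andP[? ?].
by rewrite ler_norml; apply/andP; split; lra.
Qed.

Lemma derive_comm f v w : smooth f -> 'D_v ('D_w f) = 'D_w ('D_v f).
Proof.
move=> sf; apply/funext => x; apply/eqP; rewrite -subr_eq0; apply/eqP.
apply/eqP; rewrite -normr_le0; apply/ler_addgt0Pr => e e0; rewrite add0r.
have e20 : 0 < e / 2 by rewrite divr_gt0.
have cn u u' : exists2 d : R, 0 < d & forall y, `|y - x| < d ->
    `|'D_u ('D_u' f) x - 'D_u ('D_u' f) y| < e / 2.
  have /cvgrPdist_lt/(_ _ e20) :
      'D_u ('D_u' f) y @[y --> x] --> 'D_u ('D_u' f) x.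
    exact: (smooth_continuous (smooth_derive u (smooth_derive u' sf))).
  case/nbhs_normP => d /= d0 hd; exists d => // y yd; apply: hd.
  by rewrite /ball_/= distrC.
have [d1 d10 h1] := cn v w; have [d2 d20 h2] := cn w v.
pose d := Num.min d1 d2; have d0 : 0 < d by rewrite lt_min d10.
pose c := `|v| + `|w|; have c0 : 0 <= c by rewrite addr_ge0.
pose h := d / (c + 1).
have h0 : 0 < h by rewrite divr_gt0//; lra.
have hc : h * c < d.
  by rewrite /h mulrAC ltr_pdivrMr ?ltr_pM2l//; lra.
have [y yx yE] := second_difference x v w (ltW h0) sf.
have [z zx zE] := second_difference x w v (ltW h0) sf.
(* Both sides are the same second difference divided by [h * h]; the choice of [h] puts [y] and [z]
   where the mixed derivatives are within [e / 2] of their values at [x]. *)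
have E : 'D_w ('D_v f) y = 'D_v ('D_w f) z.
  have hN0 : h != 0 by rewrite gt_eqF.
  apply: (mulIf hN0); apply: (mulIf hN0); rewrite -yE -zE.
  by rewrite (addrAC x (h *: w)); lra.
have yd : `|y - x| < d2.
  by apply: (le_lt_trans yx); apply: (lt_le_trans hc); rewrite ge_min lexx orbT.
have zd : `|z - x| < d1.
  apply: (le_lt_trans zx); rewrite (addrC `|w|); apply: (lt_le_trans hc).
  by rewrite ge_min lexx.
have t1 := h1 z zd; have t2 := h2 y yd; rewrite {}E in t2.
exact: dist_le_half t1 t2.
Qed.

Lemma derive_pderiv f v w : smooth f -> 'D_v (pderiv w f) = pderiv w ('D_v f).
Proof.
move=> sf; elim: w => [//|i w IH] /=.
by rewrite derive_comm ?IH//; exact: smooth_pderiv.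
Qed.

(** A polynomial identity sees words only up to permutation; this invariance lets it be read as an
    identity between operators. *)
Lemma pderiv_perm f w1 w2 : smooth f -> perm_eq w1 w2 ->
  pderiv w1 f = pderiv w2 f.
Proof.
move=> sf; elim: w1 w2 => [w2|i w1 IH w2 E].
  by rewrite perm_sym => /perm_nilP ->.
have : i \in w2 by rewrite -(perm_mem E) mem_head.
move=> iw2; case/splitPr: iw2 E => a b E.
have /IH /= -> : perm_eq w1 (a ++ b).
  rewrite -(perm_cons i); apply: (perm_trans E).
  by rewrite -[i :: b]cat1s perm_catCA.
rewrite /pderiv !foldr_cat/=; apply: derive_pderiv; exact: smooth_pderiv.
Qed.

Lemma derive_supp (K : set 'rV[R]_n) v f : closed K -> supported_in K f ->
  supported_in K ('D_v f).
Proof.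
move=> cK f0 x Kx.
rewrite (@near_eq_derive _ _ _ f (cst 0)) ?derive_cst//.
have : nbhs x (~` K) by apply: open_nbhs_nbhs; split=> //; exact: closed_openC.
by apply: filterS => y; exact: f0.
Qed.

Lemma pderiv_supp (K : set 'rV[R]_n) w f : closed K -> supported_in K f ->
  supported_in K (pderiv w f).
Proof.
by move=> cK f0; elim: w => [//|i w IH] /=; exact: derive_supp.
Qed.

Lemma test_funP f : test_fun setT f <->
  smooth f /\ exists2 r : R, 0 <= r & supported_in (@box R n r) f.
Proof.
split=> -[sf].
  move=> [K [cK _ f0]]; split => //; have [r r0 Kr] := compact_box cK.
  by exists r => // x xr; apply: f0 => Kx; apply: xr; exact: Kr.
move=> [r r0 f0]; split=> //; exists (@box R n r); split => //.
exact: box_compact.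
Qed.

Lemma test_fun_ccs f : test_fun setT f -> exists2 r : R, 0 <= r & ccs r f.
Proof.
move=> /test_funP[sf [r r0 f0]]; exists r => //; split => //.
exact: smooth_continuous.
Qed.

Lemma test_fun_pderiv w f : test_fun setT f -> test_fun setT (pderiv w f).
Proof.
move=> /test_funP[sf [r r0 f0]]; apply/test_funP; split.
  exact: smooth_pderiv.
exists r => //; apply: pderiv_supp => //.
by apply: compact_closed; [exact: norm_hausdorff|exact: box_compact].
Qed.

(** * Derivatives under diagonal affine substitutions *)

Variables (a b : 'I_n -> R).
Local Notation aff := (affine_diag a b).

Definition diag_scale v : 'rV[R]_n := \row_i (b i * v 0 i).

Lemma affine_diagD x v (h : R) : aff (h *: v + x) = h *: diag_scale v + aff x.
Proof. by apply/rowP => i; rewrite !mxE; ring. Qed.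

Lemma derive_affine v f x : 'D_v (f \o aff) x = 'D_(diag_scale v) f (aff x).
Proof.
apply: derive_line_ext => h /=.
by rewrite affine_diagD.
Qed.

Lemma affine_diag_differentiable x : differentiable aff x.
Proof.
have -> : aff = cst (\row_i a i) + (fun x => x *m diag_mx (\row_i b i)).
  apply/funext => y; rewrite fctE/= mul_mx_diag; apply/rowP => i.
  by rewrite !mxE mulrC.
apply: differentiableD; first exact: differentiable_cst.
apply: (@linear_differentiable _ _ _ (mulmxr (diag_mx (\row_i b i)))).
move=> y; apply/(@cvgrPdist_le _ _ _ (nbhs y)) => e e0.
pose c := \sum_i `|b i|; have c0 : 0 <= c by rewrite sumr_ge0.
have d0 : 0 < e / (c + 1) by rewrite divr_gt0//; lra.
near=> z; rewrite /= -mulmxBl; apply: mx_norm_le; first exact: ltW.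
move=> i j; rewrite mul_mx_diag !mxE normrM.
apply: (@le_trans _ _ (e / (c + 1) * c)).
  apply: ler_pM => //.
    have := mx_norm_ge (y - z) i j; rewrite !mxE => /le_trans; apply.
    by near: z; exact: (@cvgr_dist_le _ _ _ (nbhs y) _ id y (@cvg_id _ _) _ d0).
  by rewrite /c (bigD1 j)//= lerDl sumr_ge0.
rewrite mulrAC ler_pdivrMr; last lra.
by rewrite ler_pM2l//; lra.
Unshelve. all: by end_near. Qed.

Lemma smooth_affine f : smooth f -> smooth (f \o aff).
Proof.
move=> sf vs x _.
have -> : foldr (fun v g => 'D_v g) (f \o aff) vs =
    foldr (fun v g => 'D_v g) f (map diag_scale vs) \o aff.
  elim: vs => [//|v vs /= ->]; apply/funext => y; exact: derive_affine.
apply: differentiable_comp; first exact: affine_diag_differentiable.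
exact: sf.
Qed.

Lemma pderiv_affine w f x : smooth f ->
  pderiv w (f \o aff) x = (\prod_(i <- w) b i) * pderiv w f (aff x).
Proof.
move=> sf; elim: w x => [|i w IH] x; first by rewrite big_nil mul1r.
rewrite big_cons /=.
have -> : pderiv w (f \o aff) =
    (\prod_(i <- w) b i) *: (pderiv w f \o aff) by apply/funext => y; exact: IH.
have sw := smooth_pderiv w sf.
rewrite deriveZ; last first.
  by apply/diff_derivable/smooth_differentiable; exact: smooth_affine.
rewrite derive_affine/=.
have -> : diag_scale (ebasis R i) = b i *: ebasis R i.
  apply/rowP => j; rewrite !mxE eqxx/=.
  by case: eqP => [->|]//=; rewrite ?mulr0.
have dw : differentiable (pderiv w f) (aff x) by exact: smooth_differentiable sw.
by rewrite !deriveE// linearZ/= /GRing.scale/= mulrCA mulrA.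
Qed.

End Smooth.

(** * Bump functions *)

Section FlatFunctions.
Variable R : realType.
Implicit Types (p : {poly R}) (s y : R).

(* With a polynomial factor in 1/s, the functions exp(-1/s) extended by 0 form
   a family that is closed under differentiation. *)
Definition flat p s : R := if 0 < s then p.[s^-1] * expR (- s^-1) else 0.

(** The exponential series gives [y^(i+1) / (i+1)! <= exp y]. The spare factor [1 / y] becomes [s]
    when [y = 1 / s]. *)
Lemma exprn_expRN_le i y : 0 < y -> y ^+ i * expR (- y) <= i.+1`!%:R / y.
Proof.
move=> y0; rewrite ler_pdivlMr// mulrAC -exprSr expRN ler_pdivrMr ?expR_gt0//.
rewrite mulrC -ler_pdivrMr ?ltr0n ?fact_gt0//.
have := expR_ge1Dxn i (ltW y0).
by apply: le_trans; rewrite lerDr.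
Qed.

Lemma flat_bound p : exists C : R, forall s, `|flat p s| <= C * `|s|.
Proof.
exists (\sum_(i < size p) `|p`_i| * i.+1`!%:R) => s; rewrite /flat.
case: ifPn => [s0|_]; last first.
  by rewrite normr0 mulr_ge0// sumr_ge0// => i _; rewrite mulr_ge0.
have t0 : 0 < s^-1 by rewrite invr_gt0.
rewrite normrM (gtr0_norm (expR_gt0 _)) (gtr0_norm s0) horner_coef.
apply: (le_trans (ler_wpM2r (expR_ge0 _) (ler_norm_sum _ _ _))).
rewrite !big_distrl/=; apply: ler_sum => i _.
rewrite normrM -mulrA -mulrA ler_wpM2l//.
rewrite (gtr0_norm (exprn_gt0 _ t0)).
by have := exprn_expRN_le i t0; rewrite invrK.
Qed.

(** With [y = 1 / s], d/ds is [- y^2] d/dy, and d/dy of [p(y) exp(-y)] is [(p' - p)(y) exp(-y)]. *)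
Definition flat_deriv p : {poly R} := 'X^2 * (p - p^`()).

Lemma flatMX p s : flat ('X * p) s = s^-1 * flat p s.
Proof.
rewrite /flat; case: ifPn => _; last by rewrite mulr0.
by rewrite hornerM hornerX mulrA.
Qed.

Lemma flat_is_derive0 p : is_derive (0 : R) (1 : R) (flat p) 0.
Proof.
have f0 : flat p 0 = 0 by rewrite /flat ltxx.
(* The difference quotient at 0 is again a member of the family, so the linear bound sends it to
   0. *)
have E : (fun h : R => h^-1 *: (flat p (h *: 1 + 0) - flat p 0)) = flat ('X * p).
  by apply/funext => h; rewrite f0 subr0 addr0 scaler1 flatMX.
have L : flat ('X * p) h @[h --> (0 : R)^'] --> (0 : R).
  have [C hC] := flat_bound ('X * p).
  apply/cvgrPdist_le => e e0.
  have d0 : 0 < e / (`|C| + 1) by rewrite divr_gt0// ltr_wpDl.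
  near=> h; rewrite sub0r normrN; apply: (le_trans (hC h)).
  apply: (@le_trans _ _ ((`|C| + 1) * `|h|)).
    by rewrite ler_wpM2r// (le_trans (ler_norm C))// lerDl.
  rewrite mulrC -ler_pdivlMr; last by rewrite ltr_wpDl.
  by near: h; exact: dnbhs0_le.
split; first by rewrite /derivable/= E; exact: (cvgP _ L).
by rewrite /derive/= E; exact: cvg_lim.
Unshelve. all: by end_near. Qed.

Lemma flat_is_derive p s : is_derive s (1 : R) (flat p) (flat (flat_deriv p) s).
Proof.
have [s0|s0|->] := ltgtP s 0.
- have -> : flat (flat_deriv p) s = 0 by rewrite /flat ltNge (ltW s0).
  have d0 := is_derive_cst (0 : R) s (1 : R).
  apply: (near_eq_is_derive _ d0).
  near=> t; rewrite /cst/=.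
  have t0 : t < 0 by near: t; exact: lt_nbhsl.
  by rewrite /flat ltNge (ltW t0).
- rewrite {2}/flat s0.
  pose K (t : R) := p.[t] * expR (- t).
  have dK (t : R) : is_derive t (1 : R) K ((p^`()).[t] * expR (- t) - K t).
    have dE : is_derive t (1 : R) (expR \o -%R) (expR (- t) * -1).
      by apply: is_derive1_comp; exact: is_deriveNid.
    have dM := is_deriveM (is_derive_poly p t) dE.
    by apply: (is_derive_eq dM); rewrite /K /GRing.scale/=; ring.
  have dI := is_deriveV (lt0r_neq0 s0) (is_derive_id s (1 : R)).
  apply: (@near_eq_is_derive _ _ _ (K \o (fun t : R => t^-1))).
    near=> t; have t0 : 0 < t by near: t; exact: lt_nbhsr.
    by rewrite /flat t0.
  apply: (is_derive_eq (is_derive1_comp (dK s^-1) dI)).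
  rewrite /K /flat_deriv hornerM hornerD hornerN hornerXn /GRing.scale/= mulr1.
  by rewrite exprVn; ring.
- rewrite {2}/flat ltxx; exact: flat_is_derive0.
Unshelve. all: by end_near. Qed.

Lemma flat_ge0 s : 0 <= flat 1 s.
Proof. by rewrite /flat; case: ifP => // _; rewrite hornerC mul1r expR_ge0. Qed.

Lemma flat_gt0 s : (0 < flat 1 s) = (0 < s).
Proof.
by rewrite /flat; case: ifP => // _; rewrite ?ltxx// hornerC mul1r expR_gt0.
Qed.

End FlatFunctions.

(** * Bumps in several variables and the fundamental lemma of the calculus of variations *)

Section Bump.
Variables (R : realType) (n : nat).
Implicit Types (f g phi : 'rV[R]_n -> R) (x y v : 'rV[R]_n).

(** [smooth_on] quantifies over all iterated directional derivatives, so smoothness is shown through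
    a class of differentiable functions stable under differentiation; sums are included because of
    the product rule. *)
Inductive flat_alg : ('rV[R]_n -> R) -> Prop :=
| flat_alg_cst c : flat_alg (fun=> c)
| flat_alg_gen p a c i : flat_alg (fun x => flat p (a + c * x 0 i))
| flat_algD f g : flat_alg f -> flat_alg g -> flat_alg (f + g)
| flat_algM f g : flat_alg f -> flat_alg g -> flat_alg (f * g).

Lemma flat_gen_differentiable p a c i x :
  differentiable (fun x : 'rV[R]_n => flat p (a + c * x 0 i)) x.
Proof.
apply: (@differentiable_comp _ _ _ _ (fun x : 'rV[R]_n => a + c * x 0 i) (flat p)).
  apply: differentiableD; first exact: differentiable_cst.
  by apply: differentiableM; [exact: differentiable_cst|exact: differentiable_coord].
by apply/derivable1_diffP; have [] := flat_is_derive p (a + c * x 0 i).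
Qed.

Lemma flat_gen_derive p a c i x v :
  'D_v (fun x : 'rV[R]_n => flat p (a + c * x 0 i)) x =
  c * v 0 i * flat (flat_deriv p) (a + c * x 0 i).
Proof.
have [df dE] := flat_is_derive p (a + c * x 0 i).
rewrite (@derive_line_ext _ _ _ _ (flat p) _ (a + c * x 0 i) _ (c * v 0 i)).
  have /derivable1_diffP dff := df.
  rewrite -dE !deriveE// -[RHS]/((c * v 0 i) *: 'd (flat p) _ 1) -linearZ.
  by rewrite -[(c * v 0 i) *: 1]/(c * v 0 i * 1) mulr1.
by move=> h; rewrite !mxE; congr flat; rewrite /GRing.scale/=; ring.
Qed.

Lemma flat_alg_deriv f : flat_alg f ->
  (forall x, differentiable f x) /\ forall v, flat_alg ('D_v f).
Proof.
elim=> [c|p a c i|{}f g fa [df Df] ga [dg Dg]|{}f g fa [df Df] ga [dg Dg]].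
- split=> [x|v]; first exact: differentiable_cst.
  have -> : 'D_v (fun=> c) = (fun=> 0) :> ('rV[R]_n -> R).
    by apply/funext => x; exact: derive_cst.
  exact: flat_alg_cst.
- split=> [x|v]; first exact: flat_gen_differentiable.
  have -> : 'D_v (fun x : 'rV[R]_n => flat p (a + c * x 0 i)) =
      (fun=> c * v 0 i) * (fun x => flat (flat_deriv p) (a + c * x 0 i)).
    by apply/funext => x; exact: flat_gen_derive.
  by apply: flat_algM; [exact: flat_alg_cst|exact: flat_alg_gen].
- split=> [x|v]; first exact: differentiableD.
  have -> : 'D_v (f + g) = 'D_v f + 'D_v g.
    by apply/funext => x; rewrite deriveD//; exact: diff_derivable.
  exact: flat_algD.
- split=> [x|v]; first exact: differentiableM.
  have -> : 'D_v (f * g) = f * 'D_v g + g * 'D_v f.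
    by apply/funext => x; rewrite deriveM//; exact: diff_derivable.
  by apply: flat_algD; exact: flat_algM.
Qed.

Lemma flat_alg_smooth f : flat_alg f -> smooth_on setT f.
Proof.
move=> fa vs x _; pose h := foldr (fun v g => 'D_v g) f vs.
have [+ _] : (forall y, differentiable h y) /\ forall v, flat_alg ('D_v h).
  rewrite /h; elim: vs {h} => [|v vs /= [_ fvs]]; exact: flat_alg_deriv.
exact.
Qed.

Lemma flat_alg_prod (s : seq 'I_n) (F : 'I_n -> 'rV[R]_n -> R) :
  (forall i, flat_alg (F i)) -> flat_alg (fun x => \prod_(i <- s) F i x).
Proof.
move=> FA; elim: s => [|i s IH].
  under eq_fun do rewrite big_nil; exact: flat_alg_cst.
under eq_fun do rewrite big_cons; exact: flat_algM.
Qed.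

Lemma bump_exists x0 (d : R) : 0 < d -> exists phi,
  [/\ test_fun setT phi, forall x, 0 <= phi x, 0 < phi x0 &
    forall x, phi x != 0 -> forall i, `|x 0 i - x0 0 i| < d].
Proof.
move=> d0.
(* Both factors are positive exactly when [x 0 i] lies strictly within [d] of [x0 0 i]; the
   arguments are written as affine functions to match [flat_alg_gen]. *)
pose b i x := flat 1 ((d - x0 0 i) + 1 * x 0 i) *
  flat 1 ((d + x0 0 i) + (-1) * x 0 i).
have b0 i x : 0 <= b i x by rewrite mulr_ge0// flat_ge0.
have bN0 i x : b i x != 0 -> `|x 0 i - x0 0 i| < d.
  rewrite mulf_eq0 negb_or => /andP[h1 h2].
  have := flat_ge0 (d - x0 0 i + 1 * x 0 i); rewrite le_eqVlt eq_sym (negbTE h1).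
  rewrite /= flat_gt0 => ?.
  have := flat_ge0 (d + x0 0 i + (-1) * x 0 i); rewrite le_eqVlt eq_sym (negbTE h2).
  rewrite /= flat_gt0 => ?.
  by rewrite ltr_norml; apply/andP; split; lra.
pose phi x := \prod_i b i x.
have phiN0 x : phi x != 0 -> forall i, `|x 0 i - x0 0 i| < d.
  by move=> /prodf_neq0 h i; apply: bN0; exact: h.
exists phi; split => //.
- apply/test_funP; split.
    apply: flat_alg_smooth; apply: flat_alg_prod => i.
    by apply: flat_algM; exact: flat_alg_gen.
  exists (`|x0| + d); first by rewrite addr_ge0// ltW.
  move=> x; apply: contra_notP => /eqP /phiN0 h i.
  have := h i; have := mx_norm_ge x0 0 i.
  have := ler_normD (x 0 i - x0 0 i) (x0 0 i); rewrite subrK; lra.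
- by move=> x; apply: prodr_ge0.
- apply: prodr_gt0 => i _; apply: mulr_gt0; rewrite flat_gt0; lra.
Qed.

Lemma ccsM r f g : continuous g -> ccs r f -> ccs r (fun x => g x * f x).
Proof.
move=> cg [cf f0]; split=> [x|x xr]; last by rewrite f0// mulr0.
by apply: (@cvgM _ _ (nbhs x)); [exact: cg|exact: cf].
Qed.

(** If [g] were positive somewhere, a bump placed where it stays positive would give a positive
    integral; the same applies to [- g]. *)
Lemma iint_test_eq0 g : continuous g ->
  (forall phi, test_fun setT phi -> iint (fun x => g x * phi x) = 0) ->
  forall x, g x = 0.
Proof.
have pos (h : 'rV[R]_n -> R) : continuous h ->
    (forall phi, test_fun setT phi -> iint (fun x => h x * phi x) = 0) ->
    forall x, h x <= 0.
  move=> ch h0 x0; rewrite leNgt; apply/negP => hx0.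
  have /nbhs_normP[d /= d0 hd] : \forall x \near x0, 0 < h x.
    by have /cvgr_gt := ch x0; apply.
  have d20 : 0 < d / 2 by rewrite divr_gt0.
  have [phi [tphi phi0 phix0 phiN0]] := bump_exists x0 d20.
  have [r r0 cphi] := test_fun_ccs tphi.
  have := @iint_gt0 _ _ r _ x0 r0 (ccsM ch cphi).
  rewrite h0// ltxx mulr_gt0// => E; apply/notF/E => // x.
  have [->|/phiN0 xd] := eqVneq (phi x) 0; first by rewrite mulr0.
  rewrite mulr_ge0// ltW//; apply: hd; rewrite /ball_/= distrC.
  apply: (@le_lt_trans _ _ (d / 2)); last lra.
  apply: mx_norm_le => [|i j]; first exact: ltW.
  by rewrite ord1 !mxE; apply/ltW/xd.
move=> cg g0 x; apply/eqP; rewrite eq_le pos//= -oppr_le0.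
apply: (pos (fun x => - g x)) => [y|phi tphi].
  by apply: (@cvgN _ _ _ (nbhs y)); exact: cg.
have [r r0 cphi] := test_fun_ccs tphi.
have := @iint_lin _ _ r (-1) (fun x => g x * phi x) (fun=> 0) r0 (ccsM cg cphi).
(* As [-2 * y + y = - y], linearity shows that [- g] also pairs to 0. *)
have := @iint_lin _ _ r (-2) (fun x => g x * phi x) (fun x => g x * phi x) r0
  (ccsM cg cphi) (ccsM cg cphi).
rewrite g0// mulr0 addr0 => <- _; congr iint; apply/funext => y; ring.
Qed.

End Bump.

(** * Lacunary series *)

Section GeometricSeries.
Variable R : realType.
Implicit Types (q M : R).

Lemma sum_geometric_le q (m K : nat) : 0 <= q < 1 ->
  \sum_(m <= i < K) q ^+ i <= q ^+ m / (1 - q).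
Proof.
move=> /andP[q0 q1]; have q10 : 0 < 1 - q by rewrite subr_gt0.
have [Km|mK] := leqP K m.
  by rewrite big_geq// divr_ge0 ?exprn_ge0// ltW.
rewrite ler_pdivlMr// mulrC big_distrr/=.
under eq_bigr => i _ do rewrite mulrBl mul1r -exprS -[_ - _]opprB.
rewrite sumrN telescope_sumr ?(ltnW mK)// opprB.
by rewrite lerBlDr lerDl exprn_ge0.
Qed.

Lemma sum_geometric_gt1_le (r : R) (K : nat) : 1 < r ->
  \sum_(i < K) r ^+ i <= r ^+ K / (r - 1).
Proof.
move=> r1; have r10 : 0 < r - 1 by rewrite subr_gt0.
rewrite ler_pdivlMr// mulrC -subrX1; lra.
Qed.

Lemma geometric_series_cvg (X : Type) (F : nat -> X -> R) M q :
  0 <= q < 1 -> (forall k x, `|F k x| <= M * q ^+ k) ->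
  exists v : X -> R, forall K x,
    `|v x - \sum_(i < K) F i x| <= M * (q ^+ K / (1 - q)).
Proof.
move=> q01 FM.
have tail K L x : (K <= L)%N ->
    `|\sum_(i < L) F i x - \sum_(i < K) F i x| <= M * (q ^+ K / (1 - q)).
  move=> KL; rewrite -!(big_mkord xpredT (fun i => F i x)).
  rewrite (big_cat_nat (leq0n K) KL)//= addrAC subrr add0r.
  have M0 : 0 <= M by have := FM 0%N x; rewrite expr0 mulr1; exact: le_trans.
  apply: (le_trans (ler_norm_sum _ _ _)).
  apply: (@le_trans _ _ (\sum_(K <= i < L) M * q ^+ i)).
    by apply: ler_sum => i _; exact: FM.
  by rewrite -big_distrr/= ler_wpM2l// sum_geometric_le.
have cv x : cvgn (series (F^~ x)).
  apply: normed_cvg; apply: (@series_le_cvg _ _ (fun k => M * q ^+ k)) => [k|k|k|].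
  - exact: normr_ge0.
  - exact: le_trans (FM k x).
  - exact: FM.
  - by apply: is_cvg_geometric_series; case/andP: q01 => ? ?; rewrite ger0_norm.
exists (fun x => limn (series (F^~ x))) => K x.
apply/ler_addgt0Pr => e e0.
have /cvgrPdist_le/(_ e e0)[L _ hL] := cv x.
have := hL (maxn L K) (leq_maxl _ _); rewrite /series/= big_mkord => h1.
have h2 := tail K (maxn L K) x (leq_maxr _ _).
rewrite -(subrKA (\sum_(i < maxn L K) F i x)) (addrC (M * _)).
by apply: (le_trans (ler_normD _ _)); apply: lerD.
Qed.

Lemma uniform_approx_continuous (T : topologicalType) (v : T -> R) :
  (forall e : R, 0 < e -> exists2 g : T -> R, continuous g &
     forall x, `|v x - g x| <= e) -> continuous v.
Proof.
move=> h x; apply/(@cvgrPdist_le _ _ _ (nbhs x)) => e e0.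
have e30 : 0 < e / 3 by rewrite divr_gt0.
have [g cg gv] := h _ e30.
have : \forall y \near x, `|g x - g y| <= e / 3.
  by have /cvgrPdist_le/(_ _ e30) := cg x.
apply: filterS => y; have := gv x; have := gv y.
rewrite !ler_norml => /andP[? ?] /andP[? ?] /andP[? ?].
by apply/andP; split; lra.
Qed.

(* Weierstrass: at h = d / b^k the k-th term q^k g(d) dominates the lower terms
   (b is large) and the tail (q is small), while the increment h only
   decays like b^-k, and q b >= 2. *)
Lemma lacunary_not_lipschitz (g : R -> R) (B C d : R) :
  (forall s, `|g s| <= B) -> (forall s, `|g s| <= C * `|s|) -> g d != 0 ->
  exists q b : R, [/\ 0 < q < 1, 0 < b &
    forall V : R -> R,
      (forall K h, `|V h - \sum_(i < K) q ^+ i * g (b ^+ i * h)| <=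
         B * (q ^+ K / (1 - q))) ->
      ~ exists C' : R, forall h, `|V h| <= C' * `|h|].
Proof.
move=> gB gC gd.
pose m := `|g d|; have m0 : 0 < m by rewrite normr_gt0.
have mB : m <= B by exact: gB.
have B0 : 0 < B by exact: lt_le_trans mB.
have dN0 : 0 < `|d|.
  rewrite normr_gt0; apply: contra_neq gd => d0; apply/eqP.
  by rewrite -normr_le0; have := gC d; rewrite d0 normr0 mulr0.
have C0 : 0 <= C.
  by have := le_trans (normr_ge0 _) (gC d); rewrite pmulr_lge0.
(* The tail beyond the [k]-th term is at most [q^k * (q * B) / (1 - q)], which this choice makes at
   most [q^k * m / 4]. *)
have [q [q0 qB q8]] : exists q, [/\ 0 < q, 8 * (q * B) = m & q <= 8^-1].
  exists (m / (8 * B)); split; first by rewrite divr_gt0// mulr_gt0.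
    by field; rewrite gt_eqF.
  by rewrite ler_pdivrMr ?mulr_gt0// mulKf.
(* [r] will be [q * b], the ratio of the geometric bound on the lower terms. The second condition
   keeps their sum below [q^k * m / 4], the first forces the final blow-up. *)
have [r [r2 rC]] : exists r, 2 <= r /\ 4 * (C * `|d|) <= m * (r - 1).
  exists (2 + 4 * (C * `|d|) / m); split.
    by rewrite lerDl divr_ge0 ?mulr_ge0// ltW.
  rewrite -addrAC mulrDr [X in _ + X]mulrC divfK ?gt_eqF// lerDr.
  by rewrite mulr_ge0 ?ltW//; lra.
have [b [b0 qb]] : exists b, 0 < b /\ q * b = r.
  exists (r / q); split; first by rewrite divr_gt0//; lra.
  by rewrite mulrC divfK// gt_eqF.
exists q, b; split=> //; first by rewrite q0/=; lra.
move=> V hV [C' hC'].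
(* At [h = d / b^k] the [k]-th term has size [q^k * m]; lower terms and tail can each cancel a
   quarter of it, so half survives. *)
have lower k : q ^+ k * (m / 2) <= C' * (`|d| / b ^+ k).
  pose h := d / b ^+ k.
  have bk0 : 0 < b ^+ k by rewrite exprn_gt0.
  have hE : `|h| = `|d| / b ^+ k by rewrite normrM normfV (gtr0_norm bk0).
  have bh : b ^+ k * h = d by rewrite /h mulrC divfK// gt_eqF.
  have := hC' h; rewrite hE; apply: le_trans.
  have := hV k.+1 h; rewrite big_ord_recr/= bh.
  set S := \sum_(i < k) _ => tl.
  have qk0 : 0 < q ^+ k by rewrite exprn_gt0.
  have tl' : B * (q ^+ k.+1 / (1 - q)) <= q ^+ k * (m / 4).
    have -> : B * (q ^+ k.+1 / (1 - q)) = q ^+ k * (q * B / (1 - q)).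
      by rewrite exprS; ring.
    rewrite ler_pM2l// ler_pdivrMr; last lra.
    have : m * q <= m * 8^-1 by rewrite ler_pM2l.
    lra.
  have SE : `|S| <= q ^+ k * (m / 4).
    apply: (@le_trans _ _ (\sum_(i < k) (C * `|h|) * r ^+ i)).
      apply: (le_trans (ler_norm_sum _ _ _)); apply: ler_sum => i _.
      rewrite normrM (gtr0_norm (exprn_gt0 _ q0)).
      apply: (le_trans (ler_wpM2l (exprn_ge0 _ (ltW q0)) (gC _))).
      rewrite normrM (gtr0_norm (exprn_gt0 _ b0)) -qb exprMn.
      by rewrite le_eqVlt; apply/orP; left; apply/eqP; ring.
    rewrite -big_distrr/=.
    have Ch0 : 0 <= C * `|h| by rewrite mulr_ge0.
    have r1 : 1 < r by lra.
    apply: (le_trans (ler_wpM2l Ch0 (sum_geometric_gt1_le k r1))).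
    have -> : C * `|h| * (r ^+ k / (r - 1)) = q ^+ k * (C * `|d| / (r - 1)).
      rewrite hE -{1}qb exprMn; move: (q ^+ k) (b ^+ k) bk0 => x y y0.
      by field; rewrite [y == 0]gt_eqF// andbT; apply: lt0r_neq0; lra.
    rewrite ler_pM2l// ler_pdivrMr; last lra.
    by lra.
  have gE : `|q ^+ k * g d| = q ^+ k * m by rewrite normrM gtr0_norm.
  have := ler_normB (V h) (V h - q ^+ k * g d).
  rewrite opprB addrC subrK gE => t1.
  have t2 : `|V h - q ^+ k * g d| <= q ^+ k * (m / 4) + q ^+ k * (m / 4).
    rewrite (_ : _ - _ = (V h - (S + q ^+ k * g d)) + S); last by ring.
    by apply: (le_trans (ler_normD _ _)); apply: lerD => //; exact: le_trans tl'.
  lra.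
(* Multiply by [b^k] and use [q * b >= 2]: the right side is now independent of [k]. *)
have lower2 k : 2 ^+ k * (m / 2) <= C' * `|d|.
  have bk0 : 0 < b ^+ k by rewrite exprn_gt0.
  have := lower k; rewrite (mulrA C') ler_pdivlMr// mulrAC -exprMn qb.
  by apply: le_trans; rewrite ler_pM2r ?divr_gt0// lerXn2r ?nnegrE//; lra.
pose k := Num.truncn (C' * `|d| / (m / 2)).
have := lower2 k.+1; rewrite -ler_pdivlMr ?divr_gt0// leNgt => /negP; apply.
apply: (@lt_le_trans _ _ k.+1%:R); first exact: truncnS_gt.
by rewrite -natrX ler_nat ltnW// ltn_expl.
Qed.

End GeometricSeries.

(** * Distributions given by continuous functions *)

Section Pairing.
Variables (R : realType) (n : nat).
Implicit Types (v h phi : 'rV[R]_n -> R).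

Lemma pairing_lin a v h phi : continuous v -> continuous h ->
  test_fun setT phi ->
  iint (fun x => (a * v x + h x) * phi x) =
  a * iint (fun x => v x * phi x) + iint (fun x => h x * phi x).
Proof.
move=> cv ch /test_fun_ccs[r r0 cphi].
rewrite -(iint_lin a r0 (ccsM cv cphi) (ccsM ch cphi)); congr iint.
by apply/funext => x; ring.
Qed.

Lemma pairing_linr a v phi psi : continuous v ->
  test_fun setT phi -> test_fun setT psi ->
  iint (fun x => v x * (a * phi x + psi x)) =
  a * iint (fun x => v x * phi x) + iint (fun x => v x * psi x).
Proof.
move=> cv /test_fun_ccs[r r0 cphi] /test_fun_ccs[s s0 cpsi].
have rm : r <= Num.max r s by rewrite le_max lexx.
have sm : s <= Num.max r s by rewrite le_max lexx orbT.
rewrite -(@iint_lin _ _ (Num.max r s) a).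
- by congr iint; apply/funext => x; ring.
- by rewrite le_max r0.
- exact: ccs_le rm (ccsM cv cphi).
- exact: ccs_le sm (ccsM cv cpsi).
Qed.

(** The constant depends on [phi] alone, so uniform convergence of densities gives convergence of
    pairings. *)
Lemma pairing_le v phi (e : R) : continuous v -> (forall x, `|v x| <= e) ->
  test_fun setT phi ->
  `|iint (fun x => v x * phi x)| <= e * iint (fun x => `|phi x|).
Proof.
move=> cv ve /test_fun_ccs[r r0 cphi].
have cn : ccs r (fun x => `|phi x|).
  have [cf f0] := cphi; split=> [x|x xr]; last by rewrite f0// normr0.
  by apply: (@continuous_comp _ _ _ phi Num.norm); [exact: cf|exact: norm_continuous].
have ce : ccs r (fun x => e * `|phi x|).
  by apply: ccsM => //; exact: cst_continuous.
have <- : iint (fun x => e * `|phi x|) = e * iint (fun x => `|phi x|).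
  exact: iintZ cn.
have vphi x : `|v x * phi x| <= e * `|phi x|.
  by rewrite normrM ler_wpM2r.
(* The triangle inequality for the iterated integral follows from positivity, taking [a] to be 1 and
   -1. *)
have pos (a : R) : `|a| = 1 ->
    0 <= a * iint (fun x => v x * phi x) + iint (fun x => e * `|phi x|).
  move=> a1; rewrite -(iint_lin a r0 (ccsM cv cphi) ce); apply: iint_ge0 => x.
  have : `|a * (v x * phi x)| <= e * `|phi x| by rewrite normrM a1 mul1r.
  by rewrite ler_norml => /andP[]; lra.
have p1 := pos 1 (normr1 _); have p2 := pos (-1) (normrN1 _).
by rewrite ler_norml; apply/andP; split; lra.
Qed.

End Pairing.

(** * Weak solutions: linear combinations, uniform limits, weighted rescaling *)

Section Solutions.
Variables (R : realType) (n N' N : nat) (P : mxpoly R n N' N).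
Implicit Types (u v : 'I_N -> 'rV[R]_n -> R).

Definition dist_of v (j : 'I_N) (phi : 'rV[R]_n -> R) := iint (fun x => v j x * phi x).

Definition weak_sol v := dist_solution P setT (dist_of v).

Lemma bounded_vdistribution v (M : R) : (forall j, continuous (v j)) ->
  (forall j x, `|v j x| <= M) -> vdistribution setT (dist_of v).
Proof.
move=> cv vM j; split=> [a phi psi tphi tpsi|K /compact_box[r r0 Kr] _].
  exact: pairing_linr.
(* A bounded density has order 0; the constant is [M] times the volume of a box around [K], the same
   for all [phi] supported in [K]. *)
exists ((r *+ 2) ^+ n * M), 0%N => phi M' tphi Kphi phiM.
have [rs rs0 cphi] := test_fun_ccs tphi.
rewrite -mulrA; apply: le_norm_iint => //.
  apply: ccsM => //; split; first by case: cphi.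
  by move=> x xr; apply: Kphi => Kx; apply: xr; exact: Kr.
move=> x; rewrite normrM; apply: ler_pM => //.
exact: (phiM [::] x).
Qed.

Lemma weak_sol_lin (a : R) u v : (forall j, continuous (u j)) ->
  (forall j, continuous (v j)) -> weak_sol u -> weak_sol v ->
  weak_sol (fun j x => a * u j x + v j x).
Proof.
move=> cu cv su sv i phi tphi.
pose S v := \sum_(m <- P) \sum_(j < N)
  m.2 i j * ((-1) ^+ size m.1 * dist_of v j (pderiv m.1 phi)).
suff : S (fun j x => a * u j x + v j x) = a * S u + S v.
  by rewrite /S su// sv// mulr0 addr0.
rewrite /S.
rewrite big_distrr -big_split/=; apply: eq_bigr => m _.
rewrite big_distrr -big_split/=; apply: eq_bigr => j _.
rewrite /dist_of pairing_lin//; first ring.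
exact: test_fun_pderiv.
Qed.

Lemma weak_sol0 : weak_sol (fun _ _ => 0).
Proof.
move=> i phi tphi; rewrite big1// => m _; rewrite big1// => j _.
rewrite /dist_of; under eq_fun do rewrite mul0r.
by rewrite iint0 !mulr0.
Qed.

Lemma weak_sol_sum (K : nat) (q : nat -> R) (u : nat -> 'I_N -> 'rV[R]_n -> R) :
  (forall k j, continuous (u k j)) -> (forall k, weak_sol (u k)) ->
  (forall j, continuous (fun x => \sum_(k < K) q k * u k j x)) /\
  weak_sol (fun j x => \sum_(k < K) q k * u k j x).
Proof.
move=> cu su; elim: K => [|K [cK sK]].
  split.
    by move=> j; under eq_fun do rewrite big_ord0; exact: cst_continuous.
  have -> : (fun j x => \sum_(k < 0) q k * u k j x) = (fun _ _ => 0).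
    by apply/funext => j; apply/funext => x; rewrite big_ord0.
  exact: weak_sol0.
have E : (fun j x => \sum_(k < K.+1) q k * u k j x) =
    (fun j x => q K * u K j x + \sum_(k < K) q k * u k j x).
  by apply/funext => j; apply/funext => x; rewrite big_ord_recr/= addrC.
rewrite E; split; last exact: weak_sol_lin.
move=> j; have /(congr1 (fun F => F j)) /= -> := E.
move=> x; apply: (@cvgD _ _ _ (nbhs x)); last exact: cK.
by apply: (@cvgM _ _ (nbhs x)); [exact: cvg_cst|exact: cu].
Qed.

(** All derivatives fall on the test function, so uniform approximation of the densities suffices,
    with no control on their derivatives. *)
Lemma weak_sol_approx v : (forall j, continuous (v j)) ->
  (forall e : R, 0 < e -> exists u, [/\ forall j, continuous (u j), weak_sol u &
     forall j x, `|v j x - u j x| <= e]) -> weak_sol v.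
Proof.
move=> cv approx i phi tphi.
pose C := \sum_(m <- P) \sum_(j < N) `|m.2 i j| * iint (fun x => `|pderiv m.1 phi x|).
have C0 : 0 <= C.
  apply: sumr_ge0 => m _; apply: sumr_ge0 => j _.
  by rewrite mulr_ge0// iint_ge0.
apply/eqP; rewrite -normr_le0; apply/ler_addgt0Pr => e e0; rewrite add0r.
have d0 : 0 < e / (C + 1) by rewrite divr_gt0// ltr_wpDl.
have [u [cu su uv]] := approx _ d0.
rewrite -[X in `|X|]subr0 -[X in _ - X](su i phi tphi) -sumrB.
apply: (@le_trans _ _ (e / (C + 1) * C)); last first.
  by rewrite mulrAC ler_pdivrMr ?ltr_wpDl// ler_pM2l// lerDl.
rewrite big_distrr/=; apply: (le_trans (ler_norm_sum _ _ _)).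
apply: ler_sum => m _; rewrite -sumrB big_distrr/=.
apply: (le_trans (ler_norm_sum _ _ _)); apply: ler_sum => j _.
have tpsi := test_fun_pderiv m.1 tphi.
have -> : m.2 i j * ((-1) ^+ size m.1 * dist_of v j (pderiv m.1 phi)) -
    m.2 i j * ((-1) ^+ size m.1 * dist_of u j (pderiv m.1 phi)) =
    m.2 i j * ((-1) ^+ size m.1 *
      iint (fun x => (-1 * u j x + v j x) * pderiv m.1 phi x)).
  by rewrite pairing_lin// /dist_of; ring.
rewrite !normrM normrX normrN1 expr1n mul1r mulrCA ler_wpM2l//.
apply: pairing_le => //; last by move=> x; rewrite addrC mulN1r.
move=> x; apply: (@cvgD _ _ _ (nbhs x)); last exact: cv.
by apply: (@cvgM _ _ (nbhs x)); [exact: cvg_cst|exact: cu].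
Qed.

(* The intended g is w |-> (-1)^|w| T(d^w psi): comparing coefficients of the
   polynomial identity turns it into an identity between operators. *)
Lemma homogeneous_sum (c : 'I_n -> R) (d : R) i j (g : seq 'I_n -> R) :
  (forall x : 'rV[R]_n, mxpoly_eval P (\row_l (c l * x 0 l)) = d *: mxpoly_eval P x) ->
  (forall w1 w2, perm_eq w1 w2 -> g w1 = g w2) ->
  \sum_(m <- P) m.2 i j * ((\prod_(l <- m.1) c l) * g m.1) =
  d * \sum_(m <- P) m.2 i j * g m.1.
Proof.
move=> hom gP.
(* The [(i, j)] entry of the difference of the two sides of [hom], a scalar polynomial vanishing
   everywhere. *)
pose Q := [seq (m.1, (m.2 : 'M[R]_(N', N)) i j * ((\prod_(l <- m.1) c l) - d)) | m <- P].
have Q0 : \sum_(m <- Q) m.2 * g m.1 = 0.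
  apply: monomials_independent => // x.
  have /(congr1 (fun A : 'M[R]_(N', N) => A i j)) := hom x.
  rewrite /mxpoly_eval mxE !summxE big_distrr/= => /eqP.
  rewrite -subr_eq0 -sumrB => /eqP E; rewrite big_map -[RHS]E.
  apply: eq_bigr => m _ /=; rewrite !mxE.
  have -> : \prod_(l <- m.1) (\row_l (c l * x 0 l)) 0 l =
      (\prod_(l <- m.1) c l) * \prod_(l <- m.1) x 0 l.
    by rewrite -big_split/=; apply: eq_bigr => l _; rewrite mxE.
  ring.
apply/eqP; rewrite -subr_eq0 big_distrr -sumrB -[eqbRHS]Q0 big_map; apply/eqP.
by apply: eq_bigr => m _ /=; ring.
Qed.

(** The substitution is moved onto the test function by its inverse. Each word then contributes its
    own product of the [b l], and [homogeneous_sum] trades these for the common factor [d], leaving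
    a multiple of the equation for [u] tested on [psi]. *)
Lemma weak_sol_affine (a b : 'I_n -> R) (d : R) u :
  (forall x : 'rV[R]_n, mxpoly_eval P (\row_l (b l * x 0 l)) = d *: mxpoly_eval P x) ->
  (forall l, 0 < b l) -> (forall j, continuous (u j)) -> weak_sol u ->
  weak_sol (fun j x => u j (affine_diag a b x)).
Proof.
move=> hom b0 cu su i phi tphi.
pose ia l := - (a l / b l); pose ib l := (b l)^-1.
pose psi := phi \o affine_diag ia ib.
have [sphi [r r0 phi0]] := (test_funP _).1 tphi.
have spsi : smooth_on setT psi by exact: smooth_affine.
have psiE : psi \o affine_diag a b = phi.
  apply/funext => x; rewrite /psi /=; congr phi; apply/rowP => l; rewrite !mxE.
  by rewrite /ia /ib; field; rewrite gt_eqF.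
have tpsi : test_fun setT psi.
  apply/test_funP; split => //.
  exists (\sum_l (b l * r + `|a l|)).
    by apply: sumr_ge0 => l _; rewrite addr_ge0// mulr_ge0// ltW.
  move=> y; apply: contra_notP => psiy l.
  have : box r (affine_diag ia ib y) by apply: contrapT => /phi0.
  move=> /(_ l); rewrite mxE /ia /ib => yl.
  apply: (@le_trans _ _ (b l * r + `|a l|)).
    have -> : y 0 l = b l * (- (a l / b l) + (b l)^-1 * y 0 l) + a l.
      by field; rewrite gt_eqF.
    apply: (le_trans (ler_normD _ _)); rewrite lerD2r normrM gtr0_norm//.
    by rewrite ler_pM2l.
  rewrite (bigD1 l)//= lerDl sumr_ge0// => k _.
  by rewrite addr_ge0// mulr_ge0// ltW.
pose kappa := (\prod_l b l)^-1.
have distE j w : dist_of (fun j x => u j (affine_diag a b x)) j (pderiv w phi) =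
    kappa * ((\prod_(l <- w) b l) * dist_of u j (pderiv w psi)).
  have tw := test_fun_pderiv w tpsi; have [s s0 cw] := test_fun_ccs tw.
  rewrite -psiE.
  have cuw := ccsM (cu j) cw.
  rewrite /dist_of -(iintZ _ s0 cuw) -(iint_affine a s0 b0).
    congr iint; apply/funext => x /=; rewrite pderiv_affine//; ring.
  by apply: ccsM => //; exact: cst_continuous.
transitivity (kappa * \sum_j \sum_(m <- P) m.2 i j * ((\prod_(l <- m.1) b l) *
    ((-1) ^+ size m.1 * dist_of u j (pderiv m.1 psi)))).
  rewrite exchange_big/= big_distrr/=; apply: eq_bigr => m _.
  rewrite big_distrr/=; apply: eq_bigr => j _; rewrite distE; ring.
under eq_bigr => j _.
  rewrite (@homogeneous_sum b d i j
    (fun w => (-1) ^+ size w * dist_of u j (pderiv w psi)) hom).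
    over.
  by move=> w1 w2 w12; rewrite (perm_size w12) (pderiv_perm spsi w12).
by rewrite -big_distrr/= exchange_big/= su// !mulr0.
Qed.

End Solutions.

(** * The Liouville theorem *)

Section Liouville.
Variables (R : realType) (n : nat).

(** Differentiability gives the bound for small [h], boundedness for large [h]. It serves twice: to
    feed [u] into the lacunary construction, and to contradict the growth of the resulting
    series. *)
Lemma bounded_derivable_lipschitz (f : 'rV[R]_n -> R) x v (M : R) :
  derivable f x v -> (forall y, `|f y| <= M) ->
  exists C : R, forall h : R, `|f (x + h *: v) - f x| <= C * `|h|.
Proof.
move=> /cvg_ex[D hD] fM.
have M0 : 0 <= M := le_trans (normr_ge0 _) (fM x).
have {}hD := (@cvgrPdist_lt _ _ _ (0 : R)^' _ _ D).1 hD 1 ltr01.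
have : \forall h \near (0 : R), h != 0 ->
    `|D - h^-1 *: (f (h *: v + x) - f x)| < 1 by exact: hD.
case/nbhs_normP => e /= e0 he.
exists (`|D| + 1 + 2 * M / e) => h.
have Me0 : 0 <= 2 * M / e by rewrite divr_ge0 ?mulr_ge0// ltW.
have [->|hN0] := eqVneq h 0.
  by rewrite scale0r addr0 subrr !normr0 mulr0.
have h0 : 0 < `|h| by rewrite normr_gt0.
have [eh|he'] := leP e `|h|.
  apply: (@le_trans _ _ (2 * M / e * `|h|)); last first.
    by rewrite ler_wpM2r// lerDr addr_ge0.
  apply: (le_trans (ler_normB _ _)); apply: (@le_trans _ _ (2 * M)).
    by rewrite mulr_natl mulr2n lerD.
  by rewrite mulrAC ler_pdivlMr// ler_wpM2l// mulr_ge0.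
have := he h; rewrite /ball_/= sub0r normrN => /(_ he' hN0) hh.
have : `|h^-1 *: (f (h *: v + x) - f x)| <= `|D| + 1.
  have := ler_normB D (D - h^-1 *: (f (h *: v + x) - f x)).
  by rewrite opprB addrC subrK => /le_trans; apply; rewrite lerD2l ltW.
rewrite normrM normfV mulrC ler_pdivrMr// (addrC _ x) => /le_trans; apply.
by rewrite ler_wpM2r// lerDl.
Qed.

Lemma eq_along_axes (T : Type) (F : 'rV[R]_n -> T) :
  (forall x l (d : R), F (x + d *: ebasis R l) = F x) -> forall x, F x = F 0.
Proof.
move=> hF x; rewrite (row_sum_delta x).
elim: (index_enum _) => [|l s IH]; first by rewrite big_nil.
by rewrite big_cons addrC hF.
Qed.

Variables (N' N : nat) (P : mxpoly R n N' N).

Lemma bounded_solution_eq_along_axis (w : 'I_n -> R) (k : R)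
    (u : 'I_N -> 'rV[R]_n -> R) (M : R) (x0 : 'rV[R]_n) l (d : R) j :
  weakly_hypoelliptic P -> (forall i, 0 < w i) ->
  (forall (t : R) (x : 'rV[R]_n), 0 < t ->
    mxpoly_eval P (\row_i (t `^ w i * x 0 i)) = t `^ k *: mxpoly_eval P x) ->
  (forall i x, differentiable (u i) x) -> weak_sol P u ->
  (forall i x, `|u i x| <= M) ->
  u j (x0 + d *: ebasis R l) = u j x0.
Proof.
move=> hypo w0 hom du su uM; apply/eqP; apply: contraT => uN.
pose g s := u j (x0 + s *: ebasis R l) - u j x0.
have [C gC] : exists C : R, forall s : R, `|g s| <= C * `|s|.
  by apply: (bounded_derivable_lipschitz _ (uM j)); exact: diff_derivable.
have gB s : `|g s| <= 2 * M.
  by apply: (le_trans (ler_normB _ _)); rewrite mulr_natl mulr2n lerD.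
have gd : g d != 0 by rewrite subr_eq0.
have [q [b [/andP[q0 q1] b0 notlip]]] := lacunary_not_lipschitz gB gC gd.
have q01 : 0 <= q < 1 by rewrite ltW.
pose t i : R := b `^ (i%:R / w l).
have t0 i : 0 < t i by rewrite powR_gt0.
have tE i : t i `^ w l = b ^+ i.
  by rewrite /t -powRrM divfK ?gt_eqF// powR_mulrn// ltW.
pose aff i := affine_diag (fun m => x0 0 m) (fun m => t i `^ w m).
pose U i (r : 'I_N) x := u r (aff i x).
have cu r : continuous (u r) by move=> x; exact/differentiable_continuous.
have caff i : continuous (aff i).
  by move=> x; exact/differentiable_continuous/affine_diag_differentiable.
have cU i r : continuous (U i r).
  by move=> x; apply: (@continuous_comp _ _ _ (aff i) (u r));
     [exact: caff|exact: cu].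
have sU i : weak_sol P (U i).
  apply: (@weak_sol_affine _ _ _ _ _ _ _ (t i `^ k)) => //.
  - by move=> x; apply: hom.
  - by move=> m; rewrite powR_gt0.
have M0 : 0 <= M := le_trans (normr_ge0 _) (uM j x0).
(* Indexing by component and point sums all components at once, with one common error bound. *)
have [|v0 v0E] := @geometric_series_cvg R ('I_N * 'rV[R]_n)
  (fun i p => q ^+ i * U i p.1 p.2) M q q01.
  move=> i p; rewrite normrM (ger0_norm (exprn_ge0 _ (ltW q0))) (mulrC M).
  by apply: ler_wpM2l (uM _ _); rewrite exprn_ge0// ltW.
pose v r x := v0 (r, x).
have vE K r x : `|v r x - \sum_(i < K) q ^+ i * U i r x| <=
  M * (q ^+ K / (1 - q)) by exact: v0E K (r, x).
have approx (e : R) : 0 < e -> exists K, M * (q ^+ K / (1 - q)) <= e.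
  move=> e0; have q10 : 0 < 1 - q by rewrite subr_gt0.
  have d0 : 0 < e * (1 - q) / (M + 1) by rewrite divr_gt0 ?mulr_gt0// ltr_wpDl.
  have /cvgrPdist_le/(_ _ d0)[K _ hK] : q ^+ i @[i --> \oo] --> 0.
    by apply: cvg_expr; rewrite gtr0_norm.
  exists K; rewrite mulrA ler_pdivrMr//.
  have := hK K (leqnn K); rewrite /= sub0r normrN ger0_norm ?exprn_ge0 ?(ltW q0)//.
  rewrite ler_pdivlMr ?ltr_wpDl// mulrC; apply: le_trans.
  by rewrite ler_wpM2r ?exprn_ge0 ?(ltW q0)// lerDl.
have sum_sol K := @weak_sol_sum _ _ _ _ P K (fun i => q ^+ i) U cU sU.
have cv r : continuous (v r).
  apply: uniform_approx_continuous => e /approx[K Ke].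
  exists (fun x => \sum_(i < K) q ^+ i * U i r x); first exact: (sum_sol K).1.
  by move=> x; exact: le_trans (vE K r x) Ke.
have sv : weak_sol P v.
  apply: weak_sol_approx => // e /approx[K Ke].
  exists (fun r x => \sum_(i < K) q ^+ i * U i r x); have [cS sS] := sum_sol K.
  by split=> // r x; exact: le_trans (vE K r x) Ke.
have vB r x : `|v r x| <= M * (1 / (1 - q)).
  by have := vE 0%N r x; rewrite big_ord0 subr0 expr0.
have [f [sf fE]] := hypo setT openT _ (bounded_vdistribution cv vB) sv.
have df x : differentiable (fun y => f y j 0) x.
  apply: (@differentiable_comp _ _ _ _ f (fun A : 'cV[R]_N => A j 0)).
    exact: (sf [::] x I).
  exact: differentiable_coord.
(* [f] is so far only a density of the same distribution; equality at every point is needed to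
   differentiate [v j] at 0. *)
have fv : v j = (fun y => f y j 0).
  apply/funext => x; apply/eqP; rewrite -subr_eq0; apply/eqP.
  have cf : continuous (fun y => f y j 0).
    by move=> y; exact/differentiable_continuous/df.
  rewrite (_ : v j x - f x j 0 = -1 * f x j 0 + v j x); last by ring.
  apply: (@iint_test_eq0 _ _ (fun x => -1 * f x j 0 + v j x)).
    move=> y; apply: (@cvgD _ _ _ (nbhs y)); last exact: cv.
    by apply: (@cvgM _ _ (nbhs y)); [exact: cvg_cst|exact: cf].
  move=> phi tphi; rewrite pairing_lin// -(fE j phi tphi) /dist_of; ring.
pose V h := v j (h *: ebasis R l) - v j 0.
exfalso; apply: (notlip V); last first.
  have [|C' hC'] := @bounded_derivable_lipschitz (v j) 0 (ebasis R l) _ _ (vB j).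
    by rewrite fv; exact: diff_derivable.
  by exists C' => h; have := hC' h; rewrite add0r.
move=> K h; have e1 := vE K j (h *: ebasis R l); have e2 := vE K j 0.
have affE i s : aff i (s *: ebasis R l) = x0 + (b ^+ i * s) *: ebasis R l.
  apply/rowP => m; rewrite !mxE eqxx/=.
  by case: eqP => [->|_]; rewrite ?tE ?mulr0// !mulr1.
have aff0 i : aff i 0 = x0 by apply/rowP => m; rewrite !mxE mulr0 addr0.
(* Every rescaling sends 0 to [x0], so subtracting the value at 0 turns the terms [U i j] into [g].
   The two errors with constant [M] add up to [2 * M], the bound already used for [g]. *)
have -> : V h - \sum_(i < K) q ^+ i * g (b ^+ i * h) =
    (v j (h *: ebasis R l) - \sum_(i < K) q ^+ i * U i j (h *: ebasis R l)) -
    (v j 0 - \sum_(i < K) q ^+ i * U i j 0).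
  rewrite (_ : \sum_(i < K) q ^+ i * g (b ^+ i * h) =
    \sum_(i < K) q ^+ i * U i j (h *: ebasis R l) -
    \sum_(i < K) q ^+ i * U i j 0); first by rewrite /V; ring.
  rewrite -sumrB; apply: eq_bigr => i _.
  by rewrite /g /U affE aff0 mulrBr.
apply: (le_trans (ler_normB _ _)); lra.
Qed.

End Liouville.

Theorem mainTheorem5 (R : realType) (n N' N : nat) (P : mxpoly R n N' N) :
  weakly_hypoelliptic P -> weighted_homogeneous P ->
  forall u : 'rV[R]_n -> 'cV[R]_N,
    in_H P u -> (exists M : R, forall x, `|u x| <= M) ->
    exists c : 'cV[R]_N, forall x, u x = c.
Proof.
move=> hypo [w [w0 [k hom]]] u [su [T [_ solT TE]]] [M uM].
(* Any point is reached from 0 by changing one coordinate at a time. *)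
exists (u 0); apply: eq_along_axes => x l d; apply/colP => j.
apply: (@bounded_solution_eq_along_axis _ _ _ _ P w k (fun j x => u x j 0) M) => //.
- move=> i y; apply: (@differentiable_comp _ _ _ _ u (fun A : 'cV[R]_N => A i 0)).
    exact: (su [::] y I).
  exact: differentiable_coord.
- move=> i phi tphi; rewrite -[RHS](solT i phi tphi).
  apply: eq_bigr => m _; apply: eq_bigr => i' _.
  by rewrite /dist_of TE//; exact: test_fun_pderiv.
- by move=> i y; exact: le_trans (mx_norm_ge (u y) i 0) (uM y).
Qed.
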